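(* Let $(e^{tA})_{t \ge 0}$ be a $C_0$-semigroup with generator $A$ on a complex Banach space $X$. Let $E \subset X'$ be a closed, almost norming vector subspace of the dual space $X'$ and suppose that for each $x \in X$ and each $x' \in E$ there is a $p \in [1,\infty)$ (possibly depending on $x$ and $x'$) such that $$\int_0^\infty |\langle x', e^{tA}x\rangle|^p \, dt < \infty.$$ Then $s_0(A) < 0$.
   Context: $X'$ is the space of all bounded linear functionals on $X$. A vector subspace $E \subset X'$ is called almost norming if there is a constant $C > 0$ such that $\|x\| \le \sup_{x' \in E,\, \|x'\| \le 1} C\,|\langle x', x\rangle|$ for all $x \in X$. $(e^{tA})_{t\ge 0}$ denotes the $C_0$-semigroup (strongly continuous semigroup) generated by $A$, $\sigma(A)$ denotes the spectrum of $A$, and $R(\lambda,A) = (\lambda - A)^{-1}$ for $\lambda \in \mathbb{C}\setminus\sigma(A)$. The abscissa of uniform boundedness $s_0(A)$ of the resolvent of $A$ is the infimum of all real numbers $s$ such that the half-plane $\{z \in \mathbb{C} : \operatorname{Re} z \ge s\}$ is contained in the resolvent set $\mathbb{C}\setminus\sigma(A)$ and such that $R(\cdot,A)$ is uniformly bounded (in operator norm) on $\{z \in \mathbb{C} : \operatorname{Re} z \ge s\}$. *)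

(* Defs.v *)
From HB Require Import structures.
From mathcomp Require Import all_boot all_order all_algebra.
From mathcomp Require Import complex.
From mathcomp Require Import all_classical all_reals all_analysis.

Set Implicit Arguments.
Unset Strict Implicit.
Unset Printing Implicit Defensive.

Import Order.TTheory GRing.Theory Num.Theory.
Import numFieldNormedType.Exports.

Local Open Scope classical_set_scope.
Local Open Scope ring_scope.
Local Open Scope complex_scope.

Section Norms.
Context {R : realType}.

(* The library norm of a normedModType R[i] takes values in R[i]; its values are
   nonnegative reals, so nothing is lost by taking the real part. *)
Definition rnorm (V : normedModType R[i]) (v : V) : R := complex.Re `|v|.

Definition bounded_linear (V W : normedModType R[i]) (f : V -> W) : Prop :=
  linear f /\ exists M : R, forall v, rnorm (f v) <= M * rnorm v.

(* Real supremum: only meaningful for bounded maps, since sup is 0 on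
   unbounded sets. *)
Definition opnorm (V W : normedModType R[i]) (f : V -> W) : R :=
  sup [set rnorm (f v) | v in [set v : V | rnorm v <= 1]].

End Norms.

Section Dual.
Context {R : realType} (X : normedModType R[i]).

Definition dual_space : set (X -> R[i]^o) := [set f | bounded_linear f].

Definition dual_subspace (E : set (X -> R[i]^o)) : Prop :=
  [/\ E `<=` dual_space, E (fun=> 0) &
      forall (a : R[i]) f g, E f -> E g -> E (fun x => a *: f x + g x)].

(* Closedness for the norm topology of the dual. *)
Definition dual_closed (E : set (X -> R[i]^o)) : Prop :=
  forall f, dual_space f ->
    (forall eps : R, 0 < eps ->
       exists2 g, E g & opnorm (fun x => f x - g x) < eps) ->
    E f.

Definition almost_norming (E : set (X -> R[i]^o)) : Prop :=
  exists2 c : R, 0 < c &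
    forall x : X,
      rnorm x <= sup [set c * rnorm (f x) | f in [set f | E f /\ opnorm f <= 1]].

End Dual.

Section Operators.
Context {R : realType} (X : normedModType R[i]).

(* A possibly unbounded operator; the values of op outside dom are
   irrelevant. *)
Record operator := Operator { dom : set X; op : X -> X }.

(* B is the two-sided inverse of z - A : dom A -> X. *)
Definition is_resolvent (A : operator) (z : R[i]) (B : X -> X) : Prop :=
  [/\ bounded_linear B,
      forall y, dom A (B y) /\ z *: B y - op A (B y) = y &
      forall x, dom A x -> B (z *: x - op A x) = x].

Definition resolvent_set (A : operator) : set R[i] :=
  [set z | exists B, is_resolvent A z B].

Definition spectrum (A : operator) : set R[i] := ~` resolvent_set A.

Definition resolvent (z : R[i]) (A : operator) : X -> X :=
  xget (fun=> 0) [set B | is_resolvent A z B].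

(* +oo if no half-plane qualifies, -oo if all do. *)
Definition s0 (A : operator) : \bar R :=
  ereal_inf [set s%:E | s in [set s : R |
    [set z : R[i] | s <= complex.Re z] `<=` ~` spectrum A /\
    exists M : R, forall z : R[i], s <= complex.Re z ->
      opnorm (resolvent z A) <= M]].

(* Only the values T t with 0 <= t matter. *)
Definition C0_semigroup (T : R -> X -> X) : Prop :=
  [/\ forall t, 0 <= t -> bounded_linear (T t),
      T 0 = id,
      forall s t, 0 <= s -> 0 <= t -> T (s + t) = T s \o T t &
      forall x, {within `[0, +oo[, continuous (fun t => T t x)}].

Definition generator_at (T : R -> X -> X) (x y : X) : Prop :=
  (h^-1)%:C *: (T h x - x) @[h --> (0 : R)^'+] --> y.

Definition is_generator (T : R -> X -> X) (A : operator) : Prop :=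
  dom A = [set x | exists y, generator_at T x y] /\
  forall x, dom A x -> generator_at T x (op A x).

End Operators.

(* Main.v *)
(** Write [V z t x] for the integral of [e^{-z s} T(s) x] over [0, t].  If
    [g = |<x', T(.) x>|] has a finite [p]-th moment, then
    [g <= eta + eta^(1 - p) g^p] with [eta = d^(1/p)] gives
    [|<x', V z b x - V z a x>| <= e^{-d a} (1 + K) d^(1/p - 1)] as soon as
    [2 d <= Re z] and [d <= 1].  As the right-hand side increases with [p] and
    [K], the sets of pairs [(x, x')] for which the bound holds with
    [p = 1 + K = n] are closed and cover [X * E]; Baire's theorem and
    bilinearity make [n] uniform, and the norming property turns the weak bound
    into an operator bound.  Hence [V z t] converges in norm as [t] tends to
    infinity when [Re z >= 2 d], its limit is the resolvent at [z], and
    [d |R(z, A)| <= C d^(1/n)], which is smaller than [1/8] for [d] small.  A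
    Neumann series around [z + 3 d] then reaches all [z] with [Re z >= - d]. *)

Require Import Defs.
From mathcomp Require Import all_boot all_order all_algebra.
From mathcomp Require Import complex.
From mathcomp Require Import all_classical all_reals all_analysis.
From mathcomp Require Import measurable_realfun lra ring.
Import Order.TTheory GRing.Theory Num.Theory.
Import numFieldNormedType.Exports.
Local Open Scope classical_set_scope.
Local Open Scope ring_scope.

Set Implicit Arguments.
Unset Strict Implicit.
Unset Printing Implicit Defensive.

(** * Real-valued norms of complex normed modules *)

Section RealNorm.
Context {R : realType}.
Implicit Types V W : normedModType R[i].

(** The obstacle is that [p] varies with the pair, so no single L^p space is available for a closed
    graph argument; only scalar bounds indexed by [n] can be compared, and the closedness of [E] is
    what makes the pairs a complete space. The gain is that [1/p - 1 > -1]: the resolvent on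
    [Re z >= 2 d] grows strictly more slowly than [1/d], while the imaginary axis is at distance of
    order [d]. Since [d] is fixed only after [n], Baire's theorem has to be applied to all [z], [d],
    [a], [b] at once. The factor 2 in [2 d <= Re z] provides two factors [e^{-d t}]: one is kept as
    [e^{-d a}] and makes the integrals converge with no growth bound on the semigroup, the other
    integrates the constant [eta] to at most [eta / d]. Vector integrals enter only as primitives,
    that is, functions with a prescribed derivative. They are estimated by a mean value inequality
    against a monotone scalar function, so Lebesgue integration is confined to [g^p]. *)

Lemma rnormE V (v : V) : `|v| = (rnorm v)%:C%C.
Proof. by rewrite /rnorm RRe_real // normr_real. Qed.

Lemma rnorm_ge0 V (v : V) : 0 <= rnorm v.
Proof. by rewrite -ler0c -rnormE. Qed.

Lemma rnorm0 V : rnorm (0 : V) = 0.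
Proof. by rewrite /rnorm normr0. Qed.

Lemma rnorm0_eq0 V (v : V) : rnorm v = 0 -> v = 0.
Proof. by move=> h; apply/normr0_eq0; rewrite rnormE h. Qed.

Lemma rnormN V (v : V) : rnorm (- v) = rnorm v.
Proof. by rewrite /rnorm normrN. Qed.

Lemma rdistC V (v w : V) : rnorm (v - w) = rnorm (w - v).
Proof. by rewrite -rnormN opprB. Qed.

Lemma rnormD V (v w : V) : rnorm (v + w) <= rnorm v + rnorm w.
Proof. by rewrite -lecR rmorphD /= -!rnormE ler_normD. Qed.

Lemma rnormB V (v w : V) : rnorm (v - w) <= rnorm v + rnorm w.
Proof. by rewrite -(rnormN w) rnormD. Qed.

Lemma rdistD V (u v w : V) : rnorm (v - w) <= rnorm (v - u) + rnorm (u - w).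
Proof. by rewrite (le_trans _ (rnormD _ _))// addrA subrK. Qed.

Lemma rnormZ V (a : R[i]) (v : V) :
  rnorm (a *: v) = rnorm (a : R[i]^o) * rnorm v.
Proof. by apply: complexI; rewrite rmorphM /= -!rnormE normrZ. Qed.

Lemma rnorm_real (r : R) : rnorm (r%:C%C : R[i]^o) = `|r|.
Proof. by rewrite /rnorm normc_def /= expr0n addr0 sqrtr_sqr. Qed.

Lemma rnormZr V (r : R) (v : V) : rnorm (r%:C%C *: v) = `|r| * rnorm v.
Proof. by rewrite rnormZ rnorm_real. Qed.

Lemma rnorm_sum V (I : Type) (r : seq I) (F : I -> V) :
  rnorm (\sum_(i <- r) F i) <= \sum_(i <- r) rnorm (F i).
Proof.
elim: r => [|i r IH]; first by rewrite !big_nil rnorm0.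
by rewrite !big_cons (le_trans (rnormD _ _))// lerD2l.
Qed.

Lemma rnorm_le0 V (v : V) : (forall e, 0 < e -> rnorm v <= e) -> v = 0.
Proof.
move=> h; apply: rnorm0_eq0; apply/eqP.
by rewrite eq_le rnorm_ge0 andbT; apply/ler_addgt0Pr => e /h; rewrite add0r.
Qed.

Lemma rnorm_complexM (a b : R[i]) :
  rnorm (a * b : R[i]^o) = rnorm (a : R[i]^o) * rnorm (b : R[i]^o).
Proof. exact: (rnormZ a (b : R[i]^o)). Qed.

Lemma rnorm_ReIm (z : R[i]) :
  rnorm (z : R[i]^o) <= `|complex.Re z| + `|complex.Im z|.
Proof.
rewrite [z in leLHS]complexE (le_trans (rnormD _ _))//.
rewrite rnorm_real lerD2l rnorm_complexM rnorm_real.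
by rewrite /rnorm normc_def /= expr0n expr1n add0r sqrtr1 mul1r.
Qed.

Lemma Re_rnorm (z : R[i]) : `|complex.Re z| <= rnorm (z : R[i]^o).
Proof. by rewrite -lecR -rnormE; exact: normc_ge_Re. Qed.

Lemma Im_rnorm (z : R[i]) : `|complex.Im z| <= rnorm (z : R[i]^o).
Proof.
rewrite -[z in leRHS]opprK rnormN; have := Re_rnorm (z * (0 +i* 1)%C).
rewrite ReiNIm normrN rnorm_complexM => h; rewrite (le_trans h)// rnormN.
by rewrite [X in _ * X]/rnorm normc_def /= expr0n expr1n add0r sqrtr1 mulr1.
Qed.

Lemma rcauchy_cvg (V : completeNormedModType R[i]) (u : nat -> V) :
  (forall e : R, 0 < e -> exists N : nat, forall m n, (N <= m)%N -> (N <= n)%N ->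
     rnorm (u m - u n) <= e) ->
  exists l, forall e : R, 0 < e -> exists N : nat, forall n, (N <= n)%N ->
     rnorm (u n - l) <= e.
Proof.
move=> uC.
have /cvg_ex[l ul] : cvgn u.
  apply/cauchy_cvgP/cauchyP => e e0.
  have er : e = (complex.Re e)%:C%C by rewrite RRe_real // gtr0_real.
  have e0' : 0 < complex.Re e / 2 by rewrite divr_gt0// -ltcR -er.
  have [N uN] := uC _ e0'.
  exists (u N); exists N => // n /= Nn.
  rewrite -ball_normE /ball_/= rnormE er ltcR (le_lt_trans (uN _ _ _ _))//.
  by rewrite ltr_pdivrMr// ltr_pMr ?ltr1n// -ltcR -er.
exists l => e e0.
have e0' : 0 < e%:C%C :> R[i] by rewrite ltcR.
have /cvgrPdist_lt/(_ _ e0')[N _ uN] := ul.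
exists N => n Nn.
by move: (uN n Nn); rewrite /= rnormE ltcR rdistC => /ltW.
Qed.

Lemma real_cauchy_cvg (u : nat -> R) :
  (forall e : R, 0 < e -> exists N : nat, forall m n, (N <= m)%N -> (N <= n)%N ->
     `|u m - u n| <= e) ->
  exists l, forall e : R, 0 < e -> exists N : nat, forall n, (N <= n)%N ->
     `|u n - l| <= e.
Proof.
move=> uC.
have /cvg_ex[l ul] : cvgn u.
  apply/cauchy_cvgP/cauchyP => e e0.
  have [|N uN] := uC (e / 2); first by rewrite divr_gt0.
  exists (u N); exists N => // n /= Nn.
  rewrite -ball_normE /ball_/= (le_lt_trans (uN _ _ _ _))//.
  by rewrite ltr_pdivrMr// ltr_pMr ?ltr1n.
exists l => e e0.
have /cvgrPdist_lt/(_ _ e0)[N _ uN] := ul.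
exists N => n Nn.
by move: (uN n Nn); rewrite /= distrC => /ltW.
Qed.

Lemma complex_cauchy_cvg (u : nat -> R[i]^o) :
  (forall e : R, 0 < e -> exists N : nat, forall m n, (N <= m)%N -> (N <= n)%N ->
     rnorm (u m - u n) <= e) ->
  exists l : R[i]^o, forall e : R, 0 < e -> exists N : nat, forall n, (N <= n)%N ->
     rnorm (u n - l) <= e.
Proof.
move=> uC.
have [|a ua] := @real_cauchy_cvg (fun n => complex.Re (u n)).
  move=> e /uC[N uN]; exists N => m n Nm Nn.
  by rewrite (le_trans _ (uN m n Nm Nn))// -raddfB Re_rnorm.
have [|b ub] := @real_cauchy_cvg (fun n => complex.Im (u n)).
  move=> e /uC[N uN]; exists N => m n Nm Nn.
  by rewrite (le_trans _ (uN m n Nm Nn))// -raddfB Im_rnorm.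
exists (a +i* b)%C => e e0.
have e20 : 0 < e / 2 by rewrite divr_gt0.
have [N1 h1] := ua _ e20; have [N2 h2] := ub _ e20.
exists (maxn N1 N2) => n; rewrite geq_max => /andP[n1 n2].
rewrite (le_trans (rnorm_ReIm _))// (splitr e) lerD//.
  by have := h1 _ n1; case: (u n).
by have := h2 _ n2; case: (u n).
Qed.

Lemma within_continuousP V (u : R -> V) : {within `[0, +oo[, continuous u} <->
  forall t, 0 <= t -> forall e : R, 0 < e -> exists2 d, 0 < d &
    forall s, 0 <= s -> `|s - t| < d -> rnorm (u s - u t) <= e.
Proof.
split.
  move=> cu t t0 e e0.
  have tI : `[0, +oo[%classic t by rewrite /= in_itv /= t0.
  move/subspace_continuousP : cu => /(_ t tI)/cvgrPdist_lt/(_ e%:C%C).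
  rewrite ltcR => /(_ e0); rewrite /within/= => -[d /= d0 h].
  exists d => // s s0 st.
  have := h s; rewrite /= distrC in_itv /= s0 => /(_ st isT).
  by rewrite rnormE ltcR rdistC => /ltW.
move=> h; apply/subspace_continuousP => t /=; rewrite in_itv /= andbT => t0.
apply/cvgrPdist_le => e e0.
have er : e = (complex.Re e)%:C%C by rewrite RRe_real // gtr0_real.
have e0' : 0 < complex.Re e by rewrite -ltcR -er.
have [d d0 hd] := h t t0 _ e0'.
exists d => //= s /= st; rewrite in_itv /= andbT => s0.
by rewrite er rnormE lecR rdistC hd// distrC.
Qed.

Lemma generator_atP (X : normedModType R[i]) (T : R -> X -> X) x y :
  generator_at T x y <-> forall e : R, 0 < e -> exists2 d, 0 < d &
    forall h, 0 < h -> h < d ->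
      rnorm ((h^-1)%:C%C *: (T h x - x) - y) <= e.
Proof.
split.
  move=> /cvgrPdist_lt g e e0; have := g e%:C%C.
  rewrite ltcR => /(_ e0)[d /= d0 hd]; exists d => // h h0 hlt.
  have := hd h; rewrite /= sub0r normrN gtr0_norm// => /(_ hlt h0).
  by rewrite rnormE ltcR rdistC => /ltW.
move=> g; apply/cvgrPdist_le => e e0.
have er : e = (complex.Re e)%:C%C by rewrite RRe_real // gtr0_real.
have e0' : 0 < complex.Re e by rewrite -ltcR -er.
have [d d0 hd] := g _ e0'.
exists d => //= h /=; rewrite sub0r normrN => hlt h0.
rewrite er rnormE lecR rdistC hd//.
by rewrite gtr0_norm// in hlt.
Qed.

Lemma linear_opE V W (f : V -> W) : linear f ->
  [/\ f 0 = 0, {morph f : x y / x + y}, {morph f : x y / x - y},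
      {morph f : x / - x} & forall a x, f (a *: x) = a *: f x].
Proof.
move=> lf.
have f0 : f 0 = 0.
  have := lf (-1) 0 0; rewrite scaleN1r oppr0 addr0 scaleN1r => ->.
  by rewrite addNr.
have fZ a x : f (a *: x) = a *: f x by have := lf a x 0; rewrite f0 !addr0.
have fN : {morph f : x / - x} by move=> x; rewrite -[- x]scaleN1r fZ scaleN1r.
have fD : {morph f : x y / x + y}.
  by move=> x y; have := lf 1 x y; rewrite !scale1r.
by split=> // x y; rewrite fD fN.
Qed.

Lemma opnorm_le V W (f : V -> W) (M : R) : 0 <= M ->
  (forall v, rnorm (f v) <= M * rnorm v) -> opnorm f <= M.
Proof.
move=> M0 h; apply: sup_le_ub.
  by exists (rnorm (f 0)), 0 => //=; rewrite rnorm0.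
by move=> _ [v /= v1 <-]; rewrite (le_trans (h v))// ler_piMr.
Qed.

(** Boundedness of [f] makes the supremum genuine; scaling [v] to norm 1 does the rest. *)
Lemma opnormP V W (f : V -> W) v : bounded_linear f ->
  rnorm (f v) <= opnorm f * rnorm v.
Proof.
move=> [lf [M hM]]; have [f0 fD fB fN fZ] := linear_opE lf.
have ub w : rnorm w <= 1 -> rnorm (f w) <= opnorm f.
  move=> w1; apply: ub_le_sup; last by exists w.
  exists `|M| => _ [z /= z1 <-]; rewrite (le_trans (hM z))//.
  rewrite (le_trans (ler_norm _))// normrM (ger0_norm (rnorm_ge0 _)).
  by rewrite ler_piMr.
have [v0|v0] := eqVneq (rnorm v) 0.
  by rewrite (rnorm0_eq0 v0) f0 !rnorm0 mulr0.
have vp : 0 < rnorm v by rewrite lt_neqAle eq_sym v0 rnorm_ge0.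
have := ub (((rnorm v)^-1)%:C%C *: v).
rewrite fZ !rnormZr ger0_norm ?invr_ge0 ?rnorm_ge0// mulVf// => /(_ (lexx _)).
by rewrite mulrC ler_pdivrMr.
Qed.

Lemma opnorm_ge0 V W (f : V -> W) : bounded_linear f -> 0 <= opnorm f.
Proof.
move=> [lf [M hM]]; have [f0 _ _ _ _] := linear_opE lf.
apply: ub_le_sup; last by exists 0; rewrite /= ?rnorm0 // f0 rnorm0.
exists `|M| => _ [z /= z1 <-]; rewrite (le_trans (hM z))//.
rewrite (le_trans (ler_norm _))// normrM (ger0_norm (rnorm_ge0 _)).
by rewrite ler_piMr.
Qed.

Lemma bounded_linearD V W (f g : V -> W) : bounded_linear f -> bounded_linear g ->
  bounded_linear (fun x => f x + g x).
Proof.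
move=> bf bg; split.
  move=> a x y; rewrite (proj1 bf) (proj1 bg) scalerDr.
  by rewrite addrACA.
exists (opnorm f + opnorm g) => v; rewrite mulrDl (le_trans (rnormD _ _))//.
by rewrite lerD// opnormP.
Qed.

Lemma bounded_linearN V W (f : V -> W) : bounded_linear f ->
  bounded_linear (fun x => - f x).
Proof.
move=> bf; split; first by move=> a x y; rewrite (proj1 bf) opprD scalerN.
by exists (opnorm f) => v; rewrite rnormN opnormP.
Qed.

Lemma opnormD V W (f g : V -> W) : bounded_linear f -> bounded_linear g ->
  opnorm (fun x => f x + g x) <= opnorm f + opnorm g.
Proof.
move=> bf bg; apply: opnorm_le; first by rewrite addr_ge0 ?opnorm_ge0.
move=> v; rewrite mulrDl (le_trans (rnormD _ _))//.
by rewrite lerD// opnormP.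
Qed.

Lemma opnormN V W (f : V -> W) : opnorm (fun x => - f x) = opnorm f.
Proof.
rewrite /opnorm; congr (sup _); apply/seteqP.
by split=> _ [v v1 <-]; exists v => //; rewrite rnormN.
Qed.

End RealNorm.

(** * Baire category and uniform boundedness *)

Section Baire.
Context {R : realType}.

(** [N] is an arbitrary real function, so that one notion serves the norm of [X], [opnorm] and their
    sum on pairs. *)
Definition cauchy_for (V : zmodType) (N : V -> R) (u : nat -> V) :=
  forall e : R, 0 < e -> exists K : nat, forall m n, (K <= m)%N -> (K <= n)%N ->
    N (u m - u n) <= e.

Definition cvg_for (V : zmodType) (N : V -> R) (u : nat -> V) (l : V) :=
  forall e : R, 0 < e -> exists K : nat, forall n, (K <= n)%N -> N (u n - l) <= e.

(** Subadditivity is asked on [D] only, because [opnorm] behaves like a seminorm only on bounded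
    linear maps. If no ball lay inside some [B n], balls with at least halved radii could be nested
    so that the successive ones avoid [B 0], [B 1], and so on; their common point would lie in no
    [B n]. *)
Lemma seminorm_baire (V : zmodType) (N : V -> R) (D : set V) (B : nat -> set V) :
  N 0 = 0 -> (forall v w, D v -> D w -> N (v + w) <= N v + N w) ->
  (forall v, N (- v) = N v) -> D 0 -> (forall v w, D v -> D w -> D (v - w)) ->
  (forall u, (forall n : nat, D (u n)) -> cauchy_for N u ->
     exists2 l, D l & cvg_for N u l) ->
  (forall n v, D v -> ~ B n v ->
     exists2 r : R, 0 < r & forall w, D w -> N (w - v) <= r -> ~ B n w) ->
  (forall v, D v -> exists n, B n v) ->
  exists n v r, [/\ D v, 0 < r & forall w, D w -> N (w - v) <= r -> B n w].
Proof.
move=> N0 ND NN D0 DB Dcomplete Bclosed Bcover; apply: contrapT => nball.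
have N3 u v w : D u -> D v -> D w -> N (v - w) <= N (v - u) + N (u - w).
  by move=> Du Dv Dw; rewrite (le_trans _ (ND _ _ _ _))// ?addrA ?subrK//; exact: DB.
(* The conditions on the old ball sit under the existential, so that [choice] gives a total
   refinement map. *)
have step (q : nat * (V * R)) : exists q' : V * R, D q.2.1 -> 0 < q.2.2 ->
    [/\ D q'.1, 0 < q'.2, q'.2 <= q.2.2 / 2, N (q'.1 - q.2.1) <= q.2.2 / 2 &
        forall w, D w -> N (w - q'.1) <= q'.2 -> ~ B q.1 w].
  case: q => n [v r] /=.
  have [[Dv r0]|h] := pselect (D v /\ 0 < r); last first.
    by exists (v, r) => Dv r0; exfalso; apply: h.
  have r2 : 0 < r / 2 by rewrite divr_gt0.
  have [v' [Dv' v'v nB]] : exists v', [/\ D v', N (v' - v) <= r / 2 & ~ B n v'].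
    apply: contrapT => h; apply: nball; exists n, v, (r / 2); split => // w Dw wv.
    by apply: contrapT => nB; apply: h; exists w.
  have [r1 r10 hr1] := Bclosed n v' Dv' nB.
  exists (v', Num.min r1 (r / 2)) => _ _ /=; split => //.
  - by rewrite lt_min r10.
  - by rewrite ge_min lexx orbT.
  - by move=> w Dw; rewrite le_min => /andP[wr _]; exact: hr1.
have [f hf] := choice step.
pose p := fix p n := if n is n'.+1 then f (n', p n') else (0, 1).
have pP n : D (p n).1 /\ 0 < (p n).2.
  elim: n => [|n [Dn rn]] /=; first by [].
  by have [] := hf (n, p n) Dn rn.
have Dp n := proj1 (pP n).
have pS n := hf (n, p n) (proj1 (pP n)) (proj2 (pP n)).
have nested n k w : D w -> N (w - (p (n + k)%N).1) <= (p (n + k)%N).2 ->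
    N (w - (p n).1) <= (p n).2.
  move=> Dw; elim: k => [|k IH]; first by rewrite addn0.
  rewrite addnS => h; apply: IH.
  have [_ _ h1 h2 _] := pS (n + k)%N.
  rewrite (le_trans (N3 (p (n + k).+1).1 _ _ (Dp _) Dw (Dp _)))// [leRHS]splitr.
  by rewrite lerD// (le_trans h).
have rsmall n : (p n).2 <= (2 ^+ n)^-1.
  elim: n => [|n IH]; first by rewrite expr0 invr1.
  have [_ _ h1 _ _] := pS n.
  rewrite (le_trans h1)// exprSr invfM ler_wpM2r// invr_ge0 ler0n//.
have pball m n : (n <= m)%N -> N ((p m).1 - (p n).1) <= (p n).2.
  move=> nm; apply: (nested n (m - n)%N).
    exact: Dp.
  by rewrite subnKC// subrr N0 ltW// (proj2 (pP m)).
have pC : cauchy_for N (fun n => (p n).1).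
  (* Two centres beyond [K] differ by at most twice the radius [2^-K], and
     [2 / e < K + 1 <= 2 ^ K]. *)
  move=> e e0; pose K := Num.truncn (2 / e).
  exists K => m n Km Kn.
  rewrite (le_trans (N3 (p K).1 _ _ (Dp _) (Dp _) (Dp _)))//.
  rewrite -[N (_ - (p n).1)]NN opprB.
  rewrite (le_trans (lerD (pball _ _ Km) (pball _ _ Kn)))//.
  rewrite -mulr2n -mulr_natl.
  rewrite (le_trans (ler_wpM2l _ (rsmall K)))// ler_pdivrMr ?exprn_gt0//.
  rewrite mulrC -ler_pdivrMr//.
  have : 2 / e < K.+1%:R by rewrite truncnS_gt.
  move/ltW/le_trans; apply.
  by rewrite -natrX ler_nat ltn_expl.
have [l Dl pl] := Dcomplete _ Dp pC.
have lball n : N (l - (p n).1) <= (p n).2.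
  apply/ler_addgt0Pr => e e0.
  have [K hK] := pl e e0.
  rewrite (le_trans (N3 (p (maxn K n)).1 _ _ (Dp _) Dl (Dp _)))//.
  rewrite addrC lerD//.
    by rewrite pball// leq_maxr.
  by rewrite -NN opprB hK// leq_maxl.
have [n Bn] := Bcover l Dl.
by have [_ _ _ _ /(_ l Dl (lball n.+1))] := pS n.
Qed.

Implicit Types V W : normedModType R[i].

Lemma linear_ball_bound V W (f : V -> W) (r M : R) : linear f -> 0 < r ->
  (forall x, rnorm x <= r -> rnorm (f x) <= M) ->
  forall x, rnorm (f x) <= M / r * rnorm x.
Proof.
move=> /linear_opE[f0 _ _ _ fZ] r0 h x.
have [x0|x0] := eqVneq (rnorm x) 0.
  by rewrite (rnorm0_eq0 x0) f0 !rnorm0 mulr0.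
have xp : 0 < rnorm x by rewrite lt_neqAle eq_sym x0 rnorm_ge0.
have rx0 : 0 < r / rnorm x by rewrite divr_gt0.
have := h ((r / rnorm x)%:C%C *: x).
rewrite fZ !rnormZr gtr0_norm// divfK// => /(_ (lexx _)).
by rewrite mulrC -ler_pdivlMr// invf_div mulrA => /le_trans->//; rewrite mulrAC.
Qed.

Lemma uniform_boundedness (X : completeNormedModType R[i]) (I : Type)
    (P : set I) (S : I -> X -> X) :
  (forall i, P i -> bounded_linear (S i)) ->
  (forall x, exists M, forall i, P i -> rnorm (S i x) <= M) ->
  exists2 M : R, 0 <= M & forall i x, P i -> rnorm (S i x) <= M * rnorm x.
Proof.
move=> bS Sx.
have [||||||||n [v [r [_ r0 ball]]]] := @seminorm_baire X (@rnorm R X) setT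
    (fun n => [set x | forall i, P i -> rnorm (S i x) <= n%:R]).
- exact: rnorm0.
- by move=> v w _ _; exact: rnormD.
- exact: rnormN.
- by [].
- by [].
- by move=> u _ /rcauchy_cvg[l ul]; exists l.
- move=> n v _ /existsNP[i /not_implyP[Pi /negP]]; rewrite -ltNge => nv.
  have [_ _ SB _ _] := linear_opE (proj1 (bS i Pi)).
  have o1 : 0 < opnorm (S i) + 1 by rewrite ltr_wpDl// opnorm_ge0//; exact: bS.
  exists ((rnorm (S i v) - n%:R) / 2 / (opnorm (S i) + 1)).
    by rewrite !divr_gt0// subr_gt0.
  move=> w _; rewrite ler_pdivlMr// mulrC => wv /(_ i Pi) wn.
  have : rnorm (S i v) <= rnorm (S i w) + rnorm (S i (w - v)).
    by rewrite SB rdistC (le_trans _ (rnormD _ _))// addrC subrK.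
  have h1 := opnormP (w - v) (bS i Pi).
  have := rnorm_ge0 (w - v).
  nra.
- move=> x _; have [M hM] := Sx x; exists (Num.truncn M).+1 => i Pi.
  by rewrite (le_trans (hM i Pi))// ltW// truncnS_gt.
(* The ball is centred at [v]; writing [y = (v + y) - v] moves it to the origin and doubles [n]. *)
exists ((n%:R + n%:R) / r).
  by rewrite divr_ge0// ?ltW// addr_ge0.
move=> i x Pi; apply: linear_ball_bound => //; first by case: (bS i Pi).
move=> y yr; have [_ _ SB _ _] := linear_opE (proj1 (bS i Pi)).
have -> : y = (v + y) - v by rewrite addrAC subrr add0r.
rewrite SB (le_trans (rnormB _ _))// lerD// ball//.
  by rewrite addrAC subrr add0r.
by rewrite subrr rnorm0 ltW.
Qed.

(** * Completeness of the norming subspace and a Baire argument for bilinear pairings *)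

Section Dual.
Context (X : completeNormedModType R[i]) (E : set (X -> R[i]^o)).
Hypothesis E_subspace : dual_subspace E.
Hypothesis E_closed : dual_closed E.
Hypothesis E_norming : almost_norming E.

Lemma dual_subspace_bounded f : E f -> bounded_linear f.
Proof. by case: E_subspace => + _ _; exact. Qed.

Lemma dual_subspaceD f g : E f -> E g -> E (f + g).
Proof.
case: E_subspace => _ _ h Ef Eg.
suff -> : f + g = (fun x => 1 *: f x + g x) by exact: h.
by apply/funext => x; rewrite scale1r.
Qed.

Lemma dual_subspaceN f : E f -> E (- f).
Proof.
case: E_subspace => _ E0 h Ef.
suff -> : - f = (fun x => -1 *: f x + 0) by exact: h.
by apply/funext => x; rewrite addr0 scaleN1r.
Qed.

Lemma dual_subspaceB f g : E f -> E g -> E (f - g).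
Proof. by move=> Ef Eg; apply/dual_subspaceD/dual_subspaceN. Qed.

(** The limit is built pointwise, then shown to be linear, bounded and approached in [opnorm]; only
    then does [E_closed], which speaks of elements of the dual, place it in [E]. *)
Lemma dual_subspace_complete (u : nat -> X -> R[i]^o) : (forall n, E (u n)) ->
  cauchy_for (@opnorm R X R[i]^o) u ->
  exists2 l, E l & cvg_for (@opnorm R X R[i]^o) u l.
Proof.
move=> Eu uC.
have bu n := dual_subspace_bounded (Eu n).
have ptC x : cauchy_for (@rnorm R R[i]^o) (fun n => u n x).
  move=> e e0; have d0 : 0 < e / (rnorm x + 1).
    by rewrite divr_gt0// ltr_wpDl// rnorm_ge0.
  have [K hK] := uC _ d0; exists K => m n Km Kn.
  have := opnormP x (dual_subspace_bounded (dual_subspaceB (Eu m) (Eu n))).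
  have := hK m n Km Kn; rewrite ler_pdivlMr ?ltr_wpDl ?rnorm_ge0// => h1 h2.
  rewrite (le_trans h2)// (le_trans _ h1)// ler_wpM2l//.
    exact/opnorm_ge0/dual_subspace_bounded/dual_subspaceB.
  by rewrite lerDl.
have [l ul] := choice (fun x => complex_cauchy_cvg (ptC x)).
(* The second index tends to infinity at a fixed [x], which keeps the bound proportional to
   [rnorm x]. *)
have lub e K : (forall m n, (K <= m)%N -> (K <= n)%N -> opnorm (u m - u n) <= e) ->
    forall n, (K <= n)%N -> forall x, rnorm (u n x - l x) <= e * rnorm x.
  move=> hK n Kn x; apply/ler_addgt0Pr => d d0.
  have [K' hK'] := ul x d d0.
  rewrite (le_trans (rdistD (u (maxn K K') x) _ _))// lerD//; last first.
    by rewrite hK'// leq_maxr.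
  have Km : (K <= maxn K K')%N by rewrite leq_maxl.
  rewrite (le_trans (opnormP x
    (dual_subspace_bounded (dual_subspaceB (Eu n) (Eu (maxn K K'))))))//.
  by rewrite ler_wpM2r ?rnorm_ge0// hK.
have lin : linear l.
  move=> a x y; apply/eqP; rewrite -subr_eq0; apply/eqP.
  apply: rnorm_le0 => e e0.
  have e3 : 0 < e / 3 / (rnorm (a : R[i]^o) + 1).
    by rewrite !divr_gt0// ltr_wpDl// rnorm_ge0.
  have e30 : 0 < e / 3 by rewrite divr_gt0.
  have [K1 h1] := ul (a *: x + y) _ e30.
  have [K2 h2] := ul x _ e3.
  have [K3 h3] := ul y _ e30.
  pose n := maxn K1 (maxn K2 K3).
  have -> : l (a *: x + y) - (a *: l x + l y) =
      - (u n (a *: x + y) - l (a *: x + y)) + (a *: (u n x - l x) + (u n y - l y)).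
    rewrite (proj1 (bu n)) scalerBr opprB.
    rewrite [a *: u n x - _ + _]addrACA -opprD addrA.
    by rewrite subrK.
  rewrite (le_trans (rnormD _ _))// rnormN.
  have -> : e = e / 3 + (e / 3 + e / 3) by field.
  rewrite lerD ?h1 ?leq_maxl// (le_trans (rnormD _ _))// lerD ?h3//; last first.
    by rewrite /n !leq_max leqnn !orbT.
  rewrite rnormZ.
  have := h2 n; rewrite /n !leq_max leqnn !orbT => /(_ isT).
  rewrite ler_pdivlMr ?ltr_wpDl ?rnorm_ge0// => h.
  rewrite mulrC (le_trans _ h)// ler_wpM2l ?rnorm_ge0// lerDl//.
have [K hK] := uC 1 ltr01.
have lb : bounded_linear l.
  split => //; exists (opnorm (u K) + 1) => x.
  have := lub 1 K hK K (leqnn _) x; have := opnormP x (bu K).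
  have := rdistD (u K x) 0 (l x); rewrite !sub0r !rnormN; nra.
have lcvg : cvg_for (@opnorm R X R[i]^o) u l.
  move=> e e0; have [K' hK'] := uC e e0; exists K' => n Kn.
  by apply: opnorm_le; [exact: ltW|exact: lub hK' n Kn].
exists l => //; apply: E_closed => // e e0.
have e20 : 0 < e / 2 by rewrite divr_gt0.
have [K' hK'] := lcvg _ e20.
exists (u K') => //.
rewrite (le_lt_trans (y := e / 2))//; last by rewrite ltr_pdivrMr// ltr_pMr ?ltr1n.
have := hK' K' (leqnn _); rewrite -opnormN.
suff -> : (fun x => - (u K' - l) x) = (fun x => l x - u K' x) by [].
by apply/funext => x; rewrite /= opprB.
Qed.

(** Removes the supremum from the norming property; the zero functional shows that the set under it
    is nonempty. *)
Lemma norming_bound : exists2 c : R, 0 < c & forall x M,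
  (forall f, E f -> opnorm f <= 1 -> rnorm (f x) <= M) -> rnorm x <= c * M.
Proof.
have [c c0 hc] := E_norming; exists c => // x M h.
rewrite (le_trans (hc x))//; apply: sup_le_ub.
  exists (c * rnorm (0 : R[i]^o)), (fun=> 0) => //; split.
    by case: E_subspace.
  by apply: opnorm_le => // v; rewrite rnorm0 mulr_ge0// rnorm_ge0.
by move=> _ [f [Ef f1] <-]; rewrite ler_wpM2l ?(ltW c0)// h.
Qed.

(** A pair belongs to the [n]-th set when its bound holds for all [i] simultaneously, so a single
    ball of pairs, with a single [n], serves the whole family. With centre [(x0, f0)], bilinearity
    writes [g (S i y)] as an alternating sum of four values at pairs of that ball, and the norming
    property then passes from functionals to vectors. *)
Lemma bilinear_baire (I : Type) (P : set I) (S : I -> X -> X) (w : nat -> I -> R) :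
  (forall i, P i -> bounded_linear (S i)) ->
  (forall x f, E f -> exists n, forall i, P i -> rnorm (f (S i x)) <= w n i) ->
  exists n C, 0 <= C /\
    forall i x, P i -> rnorm (S i x) <= C * w n i * rnorm x.
Proof.
move=> bS hS.
pose N (q : X * (X -> R[i]^o)) := rnorm q.1 + opnorm q.2.
pose D : set (X * (X -> R[i]^o)) := [set q | E q.2].
have bE := dual_subspace_bounded.
have o0 f : E f -> 0 <= opnorm f by move/bE/opnorm_ge0.
have E0 : E 0 by case: E_subspace.
have [||||||||n [[x0 f0] [r [Df0 r0 ball]]]] := @seminorm_baire _ N D
  (fun n => [set q | forall i, P i -> rnorm (q.2 (S i q.1)) <= w n i]).
- rewrite /N/= rnorm0 add0r; apply/eqP; rewrite eq_le o0// andbT.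
  by apply: opnorm_le => // v; rewrite rnorm0 mul0r.
- move=> [x f] [y g]; rewrite /D/N/= => Ef Eg.
  by rewrite addrACA lerD ?rnormD// opnormD//; exact: bE.
- by move=> [x f]; rewrite /N/= rnormN opnormN.
- by [].
- by move=> [x f] [y g]; exact: dual_subspaceB.
- move=> u Eu uC.
  have [|y uy] := @rcauchy_cvg R X (fun n => (u n).1).
    move=> e /uC[K hK]; exists K => m n Km Kn.
    rewrite (le_trans _ (hK m n Km Kn))// lerDl o0//.
    exact: (dual_subspaceB (Eu m) (Eu n)).
  have [||g Eg ug] := @dual_subspace_complete (fun n => (u n).2) => //.
    move=> e /uC[K hK]; exists K => m n Km Kn.
    by rewrite (le_trans _ (hK m n Km Kn))// lerDr rnorm_ge0.
  exists (y, g) => // e e0; have e2 : 0 < e / 2 by rewrite divr_gt0.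
  have [K1 h1] := uy _ e2; have [K2 h2] := ug _ e2.
  exists (maxn K1 K2) => n; rewrite geq_max => /andP[n1 n2].
  by rewrite [e]splitr lerD ?h1 ?h2.
- move=> n [x f]; rewrite /D/= => Ef /existsNP[i /not_implyP[Pi /negP]]; rewrite -ltNge => nf.
  have [_ _ SB _ _] := linear_opE (proj1 (bS i Pi)).
  have [_ _ fB _ _] := linear_opE (proj1 (bE _ Ef)).
  set d := rnorm (f (S i x)) - w n i.
  have d0 : 0 < d by rewrite subr_gt0.
  pose s := opnorm (S i); have s0 : 0 <= s by exact/opnorm_ge0/bS.
  pose a := rnorm x; have a0 : 0 <= a by exact: rnorm_ge0.
  pose b := opnorm f; have b0 : 0 <= b by exact: o0.
  (* [f (S x) - g (S y)] splits into [- (g - f) (S y)] and [- f (S (y - x))]. As the 1 in the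
     minimum below forces [rnorm y <= a + 1], this constant controls both parts, and the chosen
     radius moves the value by at most [d / 2]. *)
  have k0 : 0 < s * (a + 1) + b * s + 1 by nra.
  exists (Num.min 1 (d / 2 / (s * (a + 1) + b * s + 1))).
    by rewrite lt_min ltr01 !divr_gt0.
  move=> [y g]; rewrite /D/N/= => Eg; rewrite le_min => /andP[h1].
  rewrite ler_pdivlMr// => h2 /(_ i Pi) gn.
  have gf0 := o0 _ (dual_subspaceB Eg Ef); have yx0 := rnorm_ge0 (y - x).
  have hy : rnorm y <= a + 1.
    rewrite -(subrK x y) addrC (le_trans (rnormD _ _))// lerD2l; lra.
  have h3 : rnorm ((g - f) (S i y)) <= opnorm (g - f) * (s * (a + 1)).
    rewrite (le_trans (opnormP _ (bE _ (dual_subspaceB Eg Ef))))//.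
    rewrite ler_wpM2l// (le_trans (opnormP _ (bS i Pi)))//.
    by rewrite ler_wpM2l.
  have h4 : rnorm (f (S i (y - x))) <= b * (s * rnorm (y - x)).
    rewrite (le_trans (opnormP _ (bE _ Ef)))// ler_wpM2l//.
    exact: (opnormP _ (bS i Pi)).
  have h5 : rnorm (f (S i x)) <=
      rnorm (g (S i y)) + rnorm ((g - f) (S i y)) + rnorm (f (S i (y - x))).
    have -> : f (S i x) = g (S i y) - (g - f) (S i y) - f (S i (y - x)).
      rewrite /= opprD opprK addrA subrr add0r.
      by rewrite SB fB opprB addrC subrK.
    by rewrite (le_trans (rnormB _ _))// lerD2r rnormB.
  have h6 : opnorm (g - f) * (s * (a + 1)) + b * (s * rnorm (y - x)) <=
      (rnorm (y - x) + opnorm (g - f)) * (s * (a + 1) + b * s + 1).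
    have : 0 <= s * (a + 1) by rewrite mulr_ge0// addr_ge0.
    have : 0 <= b * s by exact: mulr_ge0.
    by nra.
  rewrite /d in h2 d0; lra.
- by move=> [x f] Ef; exact: hS.
have Ef0 : E f0 by [].
have small y g : E g -> rnorm y <= r / 2 -> opnorm g <= r / 2 ->
    forall i, P i -> rnorm ((f0 + g) (S i (x0 + y))) <= w n i.
  move=> Eg yr gr; apply: (ball (x0 + y, f0 + g)).
    exact: dual_subspaceD.
  rewrite /N/= [r]splitr lerD//.
    by rewrite addrAC subrr add0r.
  by rewrite addrAC subrr add0r.
have r20 : 0 < r / 2 by rewrite divr_gt0.
have N0 : opnorm (0 : X -> R[i]^o) <= r / 2.
  by apply: opnorm_le; [exact: ltW|move=> v; rewrite rnorm0 mulr_ge0 ?rnorm_ge0// ltW].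
have w4 y g : E g -> rnorm y <= r / 2 -> opnorm g <= r / 2 ->
    forall i, P i -> rnorm (g (S i y)) <= 4 * w n i.
  move=> Eg yr gr i Pi.
  have [_ SD _ _ _] := linear_opE (proj1 (bS i Pi)).
  have [_ fD _ _ _] := linear_opE (proj1 (bE _ Ef0)).
  have [_ gD _ _ _] := linear_opE (proj1 (bE _ Eg)).
  have y0 : rnorm (0 : X) <= r / 2 by rewrite rnorm0 ltW.
  have := small y g Eg yr gr i Pi; have := small 0 g Eg y0 gr i Pi.
  have := small y 0 E0 yr N0 i Pi; have := small 0 0 E0 y0 N0 i Pi.
  have addE u : (f0 + g) u = f0 u + g u by [].
  rewrite !addr0 SD !addE fD gD => h1 h2 h3 h4.
  have -> : g (S i y) = (f0 (S i x0) + f0 (S i y) + (g (S i x0) + g (S i y)))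
     - (f0 (S i x0) + f0 (S i y)) - (f0 (S i x0) + g (S i x0)) + f0 (S i x0).
    rewrite [X in _ = X - _ + _]addrAC subrr add0r [X in _ - X + _]addrC opprD.
    by rewrite addrA subrK addrAC subrr add0r.
  have -> : 4 * w n i = w n i + w n i + w n i + w n i by ring.
  rewrite (le_trans (rnormD _ _))// lerD//.
  rewrite (le_trans (rnormB _ _))// lerD//.
  by rewrite (le_trans (rnormB _ _))// lerD//.
have [c c0 hc] := norming_bound.
(* One [2 / r] comes from scaling a functional of norm at most 1 down to [r / 2], the 4 from the
   alternating sum, the other [2 / r] from scaling the vector. *)
exists n, (c * (2 / r) * 4 * (2 / r)); split.
  by rewrite !mulr_ge0// ?invr_ge0 ltW.
move=> i x Pi.
have -> : c * (2 / r) * 4 * (2 / r) * w n i = (c * ((2 / r) * 4 * w n i)) / (r / 2).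
  rewrite invf_div; ring.
apply: linear_ball_bound => //; first by case: (bS i Pi).
move=> y yr; apply: hc => f Ef f1.
have Ef' : E (fun z => (r / 2)%:C%C *: f z).
  have [_ _ h] := E_subspace.
  suff -> : (fun z => (r / 2)%:C%C *: f z) = (fun z => (r / 2)%:C%C *: f z + 0).
    exact: h.
  by apply/funext => z; rewrite addr0.
have := w4 y _ Ef' yr.
have f'r : opnorm (fun z => (r / 2)%:C%C *: f z) <= r / 2.
  apply: opnorm_le => [|v]; first exact: ltW.
  rewrite rnormZr gtr0_norm// ler_wpM2l ?(ltW r20)//.
  by rewrite (le_trans (opnormP v (bE _ Ef)))// ler_piMl// rnorm_ge0.
move=> /(_ f'r i Pi); rewrite rnormZr gtr0_norm// => h.
by rewrite -mulrA -[2 / r]invf_div mulrC ler_pdivlMr// mulrC.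
Qed.

End Dual.
End Baire.

(** * Primitives of vector-valued continuous functions *)

Section Primitive.
Context {R : realType}.
Implicit Types V W : normedModType R[i].

(** Stands in for compactness of [[a, b]]. The step crosses each [t] from slightly before to
    slightly after; applied at the supremum of the good points, it would produce a larger good point
    unless [b] has been reached. *)
Lemma real_induction (a b : R) (Z : R -> Prop) : a <= b -> Z a ->
  (forall t : R, a <= t <= b -> exists2 d : R, 0 < d &
     forall z s : R, a <= z -> z <= t -> t <= s -> s <= b -> t - z < d -> s - t < d ->
       Z z -> Z s) ->
  Z b.
Proof.
move=> ab Za step.
pose A := [set z | a <= z <= b /\ Z z].
have Aa : A a by split=> //; rewrite lexx.
have Ab : ubound A b by move=> z [/andP[_ zb] _].
have hA : has_sup A by split; [exists a|exists b].
set c := sup A.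
have ac : a <= c by apply: ub_le_sup => //; case: hA.
have cb : c <= b by apply: sup_le_ub => //; exists a.
have [d d0 hd] : exists2 d : R, 0 < d & _ := step c (introT andP (conj ac cb)).
have [z [/andP[az zb] Zz] cz] := sup_adherent d0 hA.
have zc : z <= c by apply: ub_le_sup; [case: hA|split; rewrite ?az].
pose s := Num.min b (c + d / 2).
have d2 : 0 < d / 2 by rewrite divr_gt0.
have cs : c <= s by rewrite le_min cb lerDl ltW.
have sb : s <= b by rewrite ge_min lexx.
have Zs : Z s.
  apply: hd Zz => //; first by rewrite ltrBlDr addrC -ltrBlDr.
  rewrite ltrBlDl (le_lt_trans (y := c + d / 2))//; first by rewrite ge_min lexx orbT.
  by rewrite ltrD2l ltr_pdivrMr// ltr_pMr ?ltr1n.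
have sc : s <= c.
  by apply: ub_le_sup; [case: hA|split=> //; rewrite (le_trans ac cs)].
move: Zs sc; rewrite /s; have [//|_ _] := leP b (c + d / 2).
by rewrite gerDl leNgt d2.
Qed.

(** [G] is merely monotone, with no derivative, since it will contain the integral of [g^p]. The
    slack [e' * (t - a)] adds up along the interval, which lets the local bounds be chained by real
    induction; it vanishes because [e] is arbitrary. *)
Lemma mean_value_inequality V (F : R -> V) (G : R -> R) (a b : R) : a <= b ->
  (forall s t : R, a <= s -> s <= t -> t <= b -> G s <= G t) ->
  (forall t : R, a <= t <= b -> forall e : R, 0 < e -> exists2 d : R, 0 < d &
     forall s : R, a <= s <= b -> `|s - t| < d ->
       rnorm (F s - F t) <= `|G s - G t| + e * `|s - t|) ->
  rnorm (F b - F a) <= G b - G a.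
Proof.
move=> ab Gmono loc; apply/ler_addgt0Pr => e e0.
have k0 : 0 < b - a + 1 by rewrite ltr_wpDl// subr_ge0.
pose e' := e / (b - a + 1).
have e'0 : 0 < e' by rewrite divr_gt0.
suff h : rnorm (F b - F a) <= G b - G a + e' * (b - a).
  rewrite (le_trans h)// lerD2l /e' mulrAC ler_pdivrMr// ler_wpM2l ?(ltW e0)//.
  by rewrite lerDl.
apply: (@real_induction a b (fun t => rnorm (F t - F a) <= G t - G a + e' * (t - a))) => //.
  by rewrite !subrr mulr0 rnorm0 addr0.
move=> t /andP[at_ tb]; have [|d d0 hd] := loc t _ _ e'0; first by rewrite at_.
exists d => // z s az zt ts sb tz st Zz.
have h1 : rnorm (F s - F t) <= G s - G t + e' * (s - t).
  have /hd : a <= s <= b by rewrite sb (le_trans at_ ts).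
  by rewrite !ger0_norm ?subr_ge0 ?Gmono// => /(_ st).
have h2 : rnorm (F t - F z) <= G t - G z + e' * (t - z).
  have /hd : a <= z <= b by rewrite az (le_trans zt tb).
  rewrite rdistC distrC (distrC (G z)).
  by rewrite !ger0_norm ?subr_ge0 ?Gmono// => /(_ tz).
have h3 := rdistD (F t) (F s) (F a); have h4 := rdistD (F z) (F t) (F a).
nra.
Qed.

Definition continuous_orbit V (u : R -> V) :=
  forall t : R, 0 <= t -> forall e : R, 0 < e -> exists2 d : R, 0 < d &
    forall s : R, 0 <= s -> `|s - t| < d -> rnorm (u s - u t) <= e.

Lemma continuous_orbit_unif V (u : R -> V) (b : R) : continuous_orbit u -> 0 <= b ->
  forall e : R, 0 < e -> exists2 d : R, 0 < d &
    forall s t : R, 0 <= s <= b -> 0 <= t <= b -> `|s - t| < d -> rnorm (u s - u t) <= e.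
Proof.
move=> cu b0 e e0; pose Z b := exists2 d : R, 0 < d & forall s t : R,
  0 <= s <= b -> 0 <= t <= b -> `|s - t| < d -> rnorm (u s - u t) <= e.
apply: (@real_induction 0 b Z) => //.
  exists 1 => // s t; rewrite -!eq_le => /eqP<- /eqP<- _.
  by rewrite subrr rnorm0 ltW.
move=> t /andP[t0 tb]; have e2 : 0 < e / 2 by rewrite divr_gt0.
have [d d0 hd] := cu t t0 _ e2.
exists (d / 2); first by rewrite divr_gt0.
move=> z s z0 zt ts sb tz st [d' d'0 hd'].
exists (Num.min d' (d / 2)); first by rewrite lt_min d'0 divr_gt0.
have near x y : 0 <= x <= s -> 0 <= y <= s -> z <= x -> `|x - y| < d / 2 ->
    rnorm (u x - u y) <= e.
  move=> /andP[x0 xs] /andP[y0 ys] zx; rewrite ltr_norml => /andP[xy1 xy2].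
  rewrite (splitr e) (le_trans (rdistD (u t) _ _))// lerD//.
    by apply: hd => //; rewrite ltr_norml; apply/andP; split; lra.
  by rewrite rdistC; apply: hd => //; rewrite ltr_norml; apply/andP; split; lra.
move=> x y xs ys; rewrite lt_min => /andP[xyd' xyd].
have [zx|xz] := leP z x; first exact: near.
have [zy|yz] := leP z y; first by rewrite rdistC; apply: near => //; rewrite distrC.
by case/andP: xs => x0 _; case/andP: ys => y0 _; apply: hd'; rewrite ?x0 ?y0 ?ltW.
Qed.

(** For continuous [u] this is the integral of [u] from 0, encoded by its derivative on [[0, +oo[]
    (one-sided at 0); uniqueness is proved below. *)
Definition is_primitive V (u U : R -> V) :=
  U 0 = 0 /\ forall t : R, 0 <= t -> forall e : R, 0 < e -> exists2 d : R, 0 < d &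
    forall s : R, 0 <= s -> `|s - t| < d ->
      rnorm (U s - U t - (s - t)%:C%C *: u t) <= e * `|s - t|.

(** A form of the inequality between the norm of an integral and the integral of the norm, where [G]
    is any increasing function whose increments dominate [rnorm (u t) * |s - t|] to first order. *)
Lemma primitive_bound V (u U : R -> V) (G : R -> R) (a b : R) :
  is_primitive u U -> 0 <= a -> a <= b ->
  (forall s t : R, a <= s -> s <= t -> t <= b -> G s <= G t) ->
  (forall t : R, a <= t <= b -> forall e : R, 0 < e -> exists2 d : R, 0 < d &
     forall s : R, a <= s <= b -> `|s - t| < d ->
       rnorm (u t) * `|s - t| <= `|G s - G t| + e * `|s - t|) ->
  rnorm (U b - U a) <= G b - G a.
Proof.
move=> [_ hU] a0 ab Gmono uG; apply: mean_value_inequality => //.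
move=> t tab e e0; have e2 : 0 < e / 2 by rewrite divr_gt0.
have [d d0 hd] := uG t tab _ e2.
have [|d' d'0 hd'] := hU t _ _ e2; first by case/andP: tab => /(le_trans a0).
exists (Num.min d d'); first by rewrite lt_min d0.
move=> s sab; rewrite lt_min => /andP[sd sd'].
have s0 : 0 <= s by case/andP: sab => /(le_trans a0).
have := rnormD (U s - U t - (s - t)%:C%C *: u t) ((s - t)%:C%C *: u t).
rewrite subrK rnormZr; have := hd s sab sd; have := hd' s s0 sd'.
lra.
Qed.

Lemma primitive_lipschitz V (u U : R -> V) (M a b : R) :
  is_primitive u U -> 0 <= a -> a <= b ->
  (forall t : R, a <= t <= b -> rnorm (u t) <= M) ->
  rnorm (U b - U a) <= M * (b - a).
Proof.
move=> hU a0 ab uM.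
have M0 : 0 <= M.
  by rewrite (le_trans (rnorm_ge0 (u a)))// uM// lexx.
have -> : M * (b - a) = M * b - M * a by ring.
apply: (@primitive_bound _ u U (fun t => M * t)) => //.
  by move=> s t _ st _; rewrite ler_wpM2l.
move=> t tab e e0; exists 1 => // s sab _.
rewrite -mulrBr normrM (ger0_norm M0) ler_wpDr ?mulr_ge0 ?(ltW e0)//.
by rewrite ler_wpM2r// uM.
Qed.

Lemma primitive_linear V (u U u' U' : R -> V) (a : R[i]) :
  is_primitive u U -> is_primitive u' U' ->
  is_primitive (fun t => a *: u t + u' t) (fun t => a *: U t + U' t).
Proof.
move=> [U0 hU] [U'0 hU']; split; first by rewrite U0 U'0 scaler0 addr0.
move=> t t0 e e0; have e2 : 0 < e / 2 by rewrite divr_gt0.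
have a0 := rnorm_ge0 (a : R[i]^o).
have e2a : 0 < e / 2 / (rnorm (a : R[i]^o) + 1) by rewrite divr_gt0// ltr_wpDl.
have [d d0 hd] := hU t t0 _ e2a.
have [d' d'0 hd'] := hU' t t0 _ e2.
exists (Num.min d d'); first by rewrite lt_min d0.
move=> s s0; rewrite lt_min => /andP[/(hd _ s0) h1 /(hd' _ s0) h2].
have -> : a *: U s + U' s - (a *: U t + U' t) - (s - t)%:C%C *: (a *: u t + u' t) =
    a *: (U s - U t - (s - t)%:C%C *: u t) + (U' s - U' t - (s - t)%:C%C *: u' t).
  rewrite !scalerBr scalerDr !opprD !scalerA (mulrC a).
  by rewrite (addrACA (a *: U s)) (addrACA (a *: U s - a *: U t)).
rewrite (le_trans (rnormD _ _))// [e in e * _]splitr mulrDl lerD//.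
rewrite rnormZ (le_trans (ler_wpM2l a0 h1))// mulrA ler_wpM2r//.
rewrite mulrCA ler_piMr ?(ltW e2)// mulrC ler_pdivrMl ?ltr_wpDl// mulr1.
by rewrite lerDl.
Qed.

Lemma primitive_comp V W (u U : R -> V) (f : V -> W) : bounded_linear f ->
  is_primitive u U -> is_primitive (f \o u) (f \o U).
Proof.
move=> bf [U0 hU]; have [f0 _ fB _ fZ] := linear_opE (proj1 bf).
split => [|t t0 e e0 /=]; first by rewrite /= U0.
have o1 : 0 < opnorm f + 1 by rewrite ltr_wpDl// opnorm_ge0.
have eo : 0 < e / (opnorm f + 1) by rewrite divr_gt0.
have [d d0 hd] := hU t t0 _ eo.
exists d => // s s0 /(hd _ s0) h.
rewrite -fZ -!fB (le_trans (opnormP _ bf))//.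
rewrite (le_trans (ler_wpM2l (opnorm_ge0 bf) h))// mulrA ler_wpM2r//.
rewrite mulrCA ler_piMr ?(ltW e0)// mulrC ler_pdivrMl// mulr1.
by rewrite lerDl.
Qed.

Lemma primitive_shift V (u U : R -> V) (h : R) : 0 <= h -> is_primitive u U ->
  is_primitive (fun t => u (t + h)) (fun t => U (t + h) - U h).
Proof.
move=> h0 [U0 hU]; split => [|t t0 e e0]; first by rewrite add0r subrr.
have [|d d0 hd] := hU (t + h) _ e e0; first by rewrite addr_ge0.
exists d => // s s0 st.
have E : s + h - (t + h) = s - t by rewrite opprD addrACA subrr addr0.
have := hd (s + h) (addr_ge0 s0 h0); rewrite E => /(_ st).
by rewrite opprB addrA subrK.
Qed.

(** The difference of two primitives has derivative 0, hence Lipschitz constant 0. *)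
Lemma primitive_unique V (u U U' : R -> V) : is_primitive u U -> is_primitive u U' ->
  forall t : R, 0 <= t -> U t = U' t.
Proof.
move=> pU pU' t t0.
have : rnorm ((-1 *: U' t + U t) - (-1 *: U' 0 + U 0)) <= 0 * (t - 0).
  apply: (primitive_lipschitz (primitive_linear (-1) pU' pU)) => // s _.
  by rewrite scaleN1r addNr rnorm0.
rewrite mul0r (proj1 pU) (proj1 pU') scaler0 addr0 subr0 scaleN1r => h.
have /rnorm0_eq0/eqP : rnorm (- U' t + U t) = 0 by apply/eqP; rewrite eq_le h rnorm_ge0.
by rewrite addrC subr_eq0 => /eqP.
Qed.

(** At [x = t - k h] this is the length of the part of [[k h, (k + 1) h]] lying to the left of
    [t]. *)
Definition clamp (h x : R) := Num.min (Num.max x 0) h.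

Lemma sum_clamp (h t : R) (K : nat) : 0 < h -> 0 <= t ->
  \sum_(k < K) clamp h (t - k%:R * h) = Num.min t (K%:R * h).
Proof.
move=> h0 t0; elim: K => [|K IH].
  by rewrite big_ord0 mul0r; apply/esym/min_idPr.
rewrite big_ord_recr /= IH /clamp -natr1 mulrDl mul1r.
by rewrite !maxElt; repeat case: ltP => ?; do ?rewrite minElt;
  repeat case: ltP => ?; lra.
Qed.

Lemma clamp_mono (h s t : R) : s <= t -> clamp h s <= clamp h t.
Proof.
by move=> st; rewrite /clamp le_min !ge_min ge_max !le_max st !lexx !orbT.
Qed.

Lemma clamp_cst (h s t : R) : 0 < h -> s <= t -> (t <= 0) || (h <= s) ->
  clamp h t = clamp h s.
Proof.
move=> h0 st /orP[t0|hs]; rewrite /clamp.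
  by rewrite !max_r// (le_trans st).
by rewrite !min_r// le_max ?hs// (le_trans hs).
Qed.

(* [P] integrates the step function equal to [u (k * h)] on [k * h, (k + 1) * h). *)
Lemma approximate_primitive V (u : R -> V) (b e : R) :
  continuous_orbit u -> 0 <= b -> 0 < e ->
  exists P : R -> V, P 0 = 0 /\ exists2 h : R, 0 < h & forall s t : R,
    0 <= s <= b -> 0 <= t <= b -> `|s - t| <= h ->
    rnorm (P s - P t - (s - t)%:C%C *: u t) <= e * `|s - t|.
Proof.
move=> cu b0 e0; have [d d0 hd] := continuous_orbit_unif cu b0 e0.
(* If [t - s <= h] and a cell meets the interval from [s] to [t], its left end is within [2 h < d]
   of every point of that interval. *)
pose h := d / 3; have h0 : 0 < h by rewrite divr_gt0.
pose K := (Num.truncn (b / h)).+1.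
have bK : b <= K%:R * h by rewrite -ler_pdivrMr// ltW// truncnS_gt.
pose P t := \sum_(k < K) (clamp h (t - k%:R * h))%:C%C *: u (k%:R * h).
(* The point [r] is free because the increment must be compared with [u] at the right end when
   moving backwards and at the left end when moving forwards. *)
have main s t r : 0 <= s -> s <= t -> t <= b -> t - s <= h -> s <= r <= t ->
    rnorm (P t - P s - (t - s)%:C%C *: u r) <= e * (t - s).
  move=> s0 st tb tsh /andP[sr rt].
  have t0 := le_trans s0 st.
  have ts : t - s = \sum_(k < K) (clamp h (t - k%:R * h) - clamp h (s - k%:R * h)).
    rewrite sumrB !sum_clamp// !min_l//; first by rewrite (le_trans _ bK)// (le_trans st).
    exact: le_trans bK.
  rewrite [in leRHS]ts [in leLHS]ts rmorph_sum /= scaler_suml /P -!sumrB.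
  rewrite (le_trans (rnorm_sum _ _))// mulr_sumr ler_sum// => k _.
  rewrite -scalerBl -rmorphB /= -scalerBr rnormZr.
  have cm : clamp h (s - k%:R * h) <= clamp h (t - k%:R * h).
    by apply: clamp_mono; rewrite lerD2r.
  rewrite ger0_norm ?subr_ge0// mulrC.
  have k0 : 0 <= k%:R * h by rewrite mulr_ge0// ltW.
  have [far|] := boolP ((t - k%:R * h <= 0) || (h <= s - k%:R * h)).
    by rewrite (clamp_cst h0 _ far) ?lerD2r// subrr !mulr0.
  rewrite negb_or -!ltNge => /andP[h1 h2].
  rewrite ler_wpM2r ?subr_ge0// hd//; first by apply/andP; split; lra.
    by rewrite (le_trans s0 sr) (le_trans rt tb).
  have dh : d = 3 * h by rewrite /h; field.
  by rewrite dh ltr_norml; apply/andP; split; lra.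
exists P; split.
  rewrite /P big1// => k _; suff -> : clamp h (0 - k%:R * h) = 0 by rewrite scale0r.
  have k0 : 0 <= k%:R * h by rewrite mulr_ge0// ltW.
  by rewrite /clamp sub0r max_r ?oppr_le0// min_l// ltW.
exists h => // s t /andP[s0 sb] /andP[t0 tb].
have [st|ts] := leP s t.
  rewrite distrC ger0_norm ?subr_ge0// => h1.
  have -> : P s - P t - (s - t)%:C%C *: u t = - (P t - P s - (t - s)%:C%C *: u t).
    by rewrite !opprB addrC -scaleNr -rmorphN opprB.
  by rewrite rnormN; apply: main => //; rewrite st lexx.
rewrite gtr0_norm ?subr_gt0// => h1.
by have := main t s t t0 (ltW ts) sb h1; rewrite (ltW ts) lexx => /(_ isT).
Qed.

End Primitive.

Section PrimitiveExists.
Context {R : realType}.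

Lemma invS_small (eps : R) : 0 < eps ->
  exists K : nat, forall n : nat, (K <= n)%N -> n.+1%:R^-1 <= eps.
Proof.
move=> eps0; exists (Num.truncn eps^-1) => n Kn.
rewrite -[leRHS]invrK lef_pV2 ?posrE ?invr_gt0//.
by rewrite (le_trans (ltW (truncnS_gt _)))// ler_nat.
Qed.

Lemma subrACA (V : zmodType) (a b c d : V) : a - b - (c - d) = a - c - (b - d).
Proof. by rewrite !opprB addrACA [RHS]addrACA [- b - c]addrC. Qed.

(** Increments of the approximations are compared rather than values: [P m - P n] is Lipschitz with
    constant [e m + e n], so the factor [|s - t|] survives the limit and yields the derivative of
    [U]. *)
Lemma primitive_exists (X : completeNormedModType R[i]) (u : R -> X) :
  continuous_orbit u -> exists U, is_primitive u U.
Proof.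
move=> cu; pose e n : R := n.+1%:R^-1.
have e0 n : 0 < e n by rewrite invr_gt0.
have [P hP] := choice (fun n => approximate_primitive cu (ler0n R n) (e0 n)).
have lip m n (s t : R) : 0 <= s -> s <= t -> t <= m%:R -> t <= n%:R ->
    rnorm ((P m t - P n t) - (P m s - P n s)) <= (e m + e n) * (t - s).
  move=> s0 st tm tn; rewrite mulrBr.
  have emn := addr_ge0 (ltW (e0 m)) (ltW (e0 n)).
  apply: (@mean_value_inequality _ _ (fun t => P m t - P n t) (fun t => (e m + e n) * t)) => //.
    by move=> x y _ xy _; rewrite ler_wpM2l.
  move=> x /andP[sx xt] eps eps0.
  have [_ [hm hm0 Pm]] := hP m; have [_ [hn hn0 Pn]] := hP n.
  exists (Num.min hm hn); first by rewrite lt_min hm0.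
  move=> y /andP[sy yt]; rewrite lt_min => /andP[/ltW ym /ltW yn].
  have bnd (z : R) k : s <= z -> z <= t -> t <= k%:R -> 0 <= z <= k%:R.
    by move=> sz zt tk; rewrite (le_trans s0 sz) (le_trans zt tk).
  have h1 := Pm y x (bnd _ _ sy yt tm) (bnd _ _ sx xt tm) ym.
  have h2 := Pn y x (bnd _ _ sy yt tn) (bnd _ _ sx xt tn) yn.
  rewrite subrACA (le_trans (rdistD ((y - x)%:C%C *: u x) _ _))//.
  rewrite [X in _ + X]rdistC -mulrBr normrM (ger0_norm emn) mulrDl.
  by rewrite (le_trans (lerD h1 h2))// lerDl mulr_ge0// ltW.
have ceil (t : R) : t <= (Num.truncn t).+1%:R by rewrite ltW// truncnS_gt.
have bigN (t : R) n : ((Num.truncn t).+1 <= n)%N -> t <= n%:R.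
  by move=> tn; rewrite (le_trans (ceil t))// ler_nat.
have PC (t : R) : 0 <= t -> cauchy_for (@rnorm R X) (fun n => P n t).
  move=> t0 eps eps0; have t1 : 0 < t + 1 by rewrite ltr_wpDl.
  have [|K hK] := @invS_small (eps / 2 / (t + 1)); first by rewrite !divr_gt0.
  exists (maxn K (Num.truncn t).+1) => m n.
  rewrite !geq_max => /andP[Km tm] /andP[Kn tn].
  have := lip m n 0 t (lexx _) t0 (bigN _ _ tm) (bigN _ _ tn).
  rewrite (proj1 (hP m)) (proj1 (hP n)) !subr0 => /le_trans; apply.
  have := hK _ Km; have := hK _ Kn; rewrite -/(e m) -/(e n) !ler_pdivlMr//.
  have := e0 m; have := e0 n; nra.
have lim (t : R) : exists l, 0 <= t -> cvg_for (@rnorm R X) (fun n => P n t) l.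
  have [t0|_] := leP 0 t; last by exists 0.
  by have [l hl] := rcauchy_cvg (PC t t0); exists l.
have [U hU] := choice lim.
have lipU n (s t : R) : 0 <= s -> s <= t -> t <= n%:R ->
    rnorm ((U t - U s) - (P n t - P n s)) <= 2 * e n * (t - s).
  move=> s0 st tn; apply/ler_addgt0Pr => d d0.
  have t0 := le_trans s0 st; have d2 : 0 < d / 2 by rewrite divr_gt0.
  have [K1 h1] := hU s s0 _ d2; have [K2 h2] := hU t t0 _ d2.
  pose m := maxn n (maxn K1 K2).
  have nm : (n <= m)%N by rewrite leq_maxl.
  have emn : e m <= e n by rewrite /e lef_pV2 ?posrE// ler_nat.
  have tm : t <= m%:R by rewrite (le_trans tn)// ler_nat.
  have h3 := lip m n s t s0 st tm tn.
  have {}h1 : rnorm (P m s - U s) <= d / 2 by rewrite h1// /m !leq_max leqnn orbT.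
  have {}h2 : rnorm (P m t - U t) <= d / 2 by rewrite h2// /m !leq_max leqnn !orbT.
  rewrite (le_trans (rdistD (P m t - P m s) _ _))// addrC lerD//.
    rewrite subrACA (le_trans h3)// ler_wpM2r ?subr_ge0//; lra.
  rewrite subrACA (le_trans (rnormB _ _))// [d]splitr lerD//; first by rewrite rdistC.
  by rewrite rdistC.
exists U; split.
  apply: rnorm_le0 => d d0; have [K hK] := hU 0 (lexx 0) d d0.
  by have := hK K (leqnn _); rewrite (proj1 (hP K)) sub0r rnormN.
(* [P n] contributes an error [e n] and its distance to [U] contributes [2 * e n], hence the thirds;
   [t + 1 <= n] leaves room for [s] on both sides of [t]. *)
move=> t t0 eps eps0; have eps3 : 0 < eps / 3 by rewrite divr_gt0.
have [K hK] := invS_small eps3.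
pose n := maxn K (Num.truncn (t + 1)).+1.
have tn : t + 1 <= n%:R by rewrite bigN// leq_maxr.
have en : e n <= eps / 3 by rewrite hK// leq_maxl.
have [_ [h h0 hn]] := hP n.
exists (Num.min h 1); first by rewrite lt_min h0 ltr01.
move=> s s0; rewrite lt_min => /andP[/ltW sth st1].
have tn' : t <= n%:R by rewrite (le_trans _ tn)// lerDl.
have sn : s <= n%:R.
  by rewrite (le_trans _ tn)// -lerBlDl (le_trans (ler_norm _))// ltW.
have h1 : rnorm (P n s - P n t - (s - t)%:C%C *: u t) <= e n * `|s - t|.
  by apply: hn; rewrite ?s0 ?t0.
have h2 : rnorm (U s - U t - (P n s - P n t)) <= 2 * e n * `|s - t|.
  have [st|/ltW ts] := leP s t.
    rewrite distrC ger0_norm ?subr_ge0//.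
    rewrite -[U s - U t]opprB -[P n s - P n t]opprB -opprD rnormN.
    exact: lipU.
  by rewrite ger0_norm ?subr_ge0//; exact: lipU.
rewrite (le_trans (rdistD (P n s - P n t) _ _))//.
have := normr_ge0 (s - t); nra.
Qed.

End PrimitiveExists.

(** * Semigroups and the resolvent of their generator *)

Section ComplexExp.
Context {R : realType}.

Lemma is_derive_eps (f : R -> R) (df : R) : is_derive (0 : R) 1 f df ->
  forall e, 0 < e -> exists2 d : R, 0 < d & forall h, `|h| < d ->
    `|f h - f 0 - h * df| <= e * `|h|.
Proof.
move=> fdf e e0.
have : h^-1 *: (f h - f 0) @[h --> (0 : R)^'] --> df.
  have := @ex_derive _ _ _ _ _ _ _ fdf; rewrite /derivable.
  rewrite -(@derive_val _ _ _ _ _ _ _ fdf) /derive.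
  suff -> : (fun h => h^-1 *: ((f \o shift 0) (h *: 1) - f 0)) =
      (fun h => h^-1 *: (f h - f 0)) by [].
  by apply/funext => h; rewrite /= addr0 [_ *: 1]mulr1.
move=> /cvgrPdist_le/(_ e e0)[d /= d0 hd].
exists d => // h hlt; have [->|h0] := eqVneq h 0.
  by rewrite subrr mul0r subrr normr0 mulr0.
have := hd h; rewrite /= sub0r normrN => /(_ hlt h0).
have -> : f h - f 0 - h * df = - (h * (df - h^-1 *: (f h - f 0))).
  by rewrite -[_ *: _]/(_ * _) mulrBr mulrA divff// mul1r opprB.
by rewrite normrN normrM mulrC => k; rewrite ler_wpM2r.
Qed.

Definition cexp (z : R[i]) (t : R) : R[i] :=
  ((expR (complex.Re z * t) * cos (complex.Im z * t)) +i*
   (expR (complex.Re z * t) * sin (complex.Im z * t)))%C.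

Lemma cexp0 z : cexp z 0 = 1.
Proof. by rewrite /cexp !mulr0 expR0 cos0 sin0 mulr0 mulr1. Qed.

Lemma cexpD z s t : cexp z (s + t) = cexp z s * cexp z t.
Proof.
rewrite /cexp !mulrDr expRD cosD sinD; apply/eqP; rewrite eq_complex /=.
by apply/andP; split; apply/eqP; ring.
Qed.

Lemma rnorm_cexp z t : rnorm (cexp z t : R[i]^o) = expR (complex.Re z * t).
Proof.
rewrite /rnorm normc_def /= !exprMn -mulrDr cos2Dsin2 mulr1 sqrtr_sqr.
by rewrite ger0_norm// expR_ge0.
Qed.

Lemma cexpN z t : cexp (- z) t * cexp z t = 1.
Proof.
suff -> : cexp (- z) t = cexp z (- t) by rewrite -cexpD addNr cexp0.
by case: z => a b; rewrite /cexp /= !mulNr !mulrN.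
Qed.

Lemma cexp_derive0 z e : 0 < e -> exists2 d : R, 0 < d & forall h, `|h| < d ->
  rnorm (cexp z h - 1 - h%:C%C * z : R[i]^o) <= e * `|h|.
Proof.
move=> e0; case: z => a b.
have dE (c : R) : is_derive (0 : R) 1 (fun h : R => c * h) c.
  by apply: is_derive_eq; rewrite /= ?scaler0 ?addr0 ?add0r [_ *: _]mulr1.
have d1 : is_derive (0 : R) 1 (fun h : R => expR (a * h) * cos (b * h)) a.
  apply: is_derive_eq; rewrite /= !mulr0 expR0 cos0 sin0 -![_ *: _]/(_ * _).
  by ring.
have d2 : is_derive (0 : R) 1 (fun h : R => expR (a * h) * sin (b * h)) b.
  apply: is_derive_eq; rewrite /= !mulr0 expR0 cos0 sin0 -![_ *: _]/(_ * _).
  by ring.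
have e2 : 0 < e / 2 by rewrite divr_gt0.
have [r1 r10 h1] := is_derive_eps d1 e2; have [r2 r20 h2] := is_derive_eps d2 e2.
exists (Num.min r1 r2); first by rewrite lt_min r10.
move=> h; rewrite lt_min => /andP[/h1 + /h2].
rewrite !mulr0 expR0 cos0 sin0 mulr0 mulr1 subr0 => {}h1 {}h2.
rewrite (le_trans (rnorm_ReIm _))//.
have -> : e * `|h| = e / 2 * `|h| + e / 2 * `|h| by rewrite -mulrDl -splitr.
rewrite lerD//=.
  by rewrite mul0r subr0.
by rewrite mul0r addr0 oppr0 addr0.
Qed.

Lemma cexp_sub1 z : exists2 d : R, 0 < d & forall h, `|h| < d ->
  rnorm (cexp z h - 1 : R[i]^o) <= (rnorm (z : R[i]^o) + 1) * `|h|.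
Proof.
have [d d0 hd] := cexp_derive0 z ltr01.
exists d => // h /hd; rewrite mul1r => h1.
have := rnormD (cexp z h - 1 - h%:C%C * z : R[i]^o) (h%:C%C * z : R[i]^o).
rewrite subrK rnorm_complexM rnorm_real => /le_trans; apply; lra.
Qed.

End ComplexExp.

Section Semigroup.
Context {R : realType} (X : completeNormedModType R[i]) (S : R -> X -> X).
Hypothesis S_semigroup : C0_semigroup S.

Lemma semigroup_bounded t : 0 <= t -> bounded_linear (S t).
Proof. by case: S_semigroup => + _ _ _; exact. Qed.

Lemma semigroupD s t x : 0 <= s -> 0 <= t -> S (s + t) x = S s (S t x).
Proof. by case: S_semigroup => _ _ h _ s0 t0; rewrite h. Qed.

Lemma semigroup0 x : S 0 x = x.
Proof. by case: S_semigroup => _ -> _ _. Qed.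

Lemma semigroup_orbit x : continuous_orbit (fun t => S t x).
Proof. by case: S_semigroup => _ _ _ h; apply/within_continuousP/h. Qed.

Lemma continuous_orbit_bounded (V : normedModType R[i]) (u : R -> V) (b : R) :
  continuous_orbit u -> 0 <= b ->
  exists M, forall t, 0 <= t <= b -> rnorm (u t) <= M.
Proof.
move=> cu b0.
apply: (@real_induction R 0 b
  (fun b => exists M, forall t, 0 <= t <= b -> rnorm (u t) <= M)) => //.
  by exists (rnorm (u 0)) => t; rewrite -eq_le => /eqP<-.
move=> t /andP[t0 tb]; have [d d0 hd] := cu t t0 1 ltr01.
exists d => // z s z0 zt ts sb tz st [M hM].
exists (Num.max M (rnorm (u t) + 1)) => r /andP[r0 rs]; rewrite le_max.
have [rz|zr] := leP r z; first by rewrite hM ?r0.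
apply/orP; right; have := rdistD (u t) (u r) 0; rewrite !subr0 => /le_trans; apply.
rewrite addrC lerD2l hd// ltr_norml; apply/andP; split; lra.
Qed.

(** Strong continuity bounds each orbit on [[0, b]]; uniform boundedness makes the constant
    common. *)
Lemma semigroup_locally_bounded (b : R) : 0 <= b ->
  exists2 M, 0 <= M & forall t x, 0 <= t <= b -> rnorm (S t x) <= M * rnorm x.
Proof.
move=> b0; apply: (@uniform_boundedness R X R [set t | 0 <= t <= b] S).
  by move=> t /= /andP[t0 _]; exact: semigroup_bounded.
by move=> x; have := continuous_orbit_bounded (semigroup_orbit x) b0.
Qed.

Lemma is_primitive_eq (V : normedModType R[i]) (u u' U : R -> V) :
  (forall t, 0 <= t -> u t = u' t) -> is_primitive u U -> is_primitive u' U.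
Proof.
move=> uu' [U0 hU]; split=> // t t0 e e0; have [d d0 hd] := hU t t0 e e0.
by exists d => // s s0 st; rewrite -uu'// hd.
Qed.

Context (V : R -> X -> X).
Hypothesis V_primitive : forall x, is_primitive (fun t => S t x) (fun t => V t x).

Lemma semigroup_primitive_bounded t : 0 <= t -> bounded_linear (V t).
Proof.
move=> t0; split.
  move=> a x y.
  have := primitive_linear a (V_primitive x) (V_primitive y).
  move=> /(@is_primitive_eq _ _ (fun t => S t (a *: x + y))) h.
  apply: (primitive_unique (V_primitive (a *: x + y)) (h _)) => // s s0.
  by rewrite (proj1 (semigroup_bounded s0)).
have [M M0 hM] := semigroup_locally_bounded t0.
exists (M * t) => x.
have := primitive_lipschitz (V_primitive x) (lexx 0) t0 (M := M * rnorm x).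
rewrite (proj1 (V_primitive x)) !subr0 mulrAC; apply => s st.
exact: hM.
Qed.

(** Both sides are primitives of the orbit shifted by [h]. *)
Lemma semigroup_primitive_shift h t x : 0 <= h -> 0 <= t ->
  S h (V t x) = V (t + h) x - V h x.
Proof.
move=> h0 t0.
have := primitive_comp (semigroup_bounded h0) (V_primitive x).
move=> /(@is_primitive_eq _ _ (fun t => S (t + h) x)) p.
apply: (primitive_unique (p _) (primitive_shift h0 (V_primitive x))) => // s s0 /=.
by rewrite addrC semigroupD.
Qed.

Lemma semigroup_primitive_comm h t x : 0 <= h -> 0 <= t ->
  V t (S h x) = S h (V t x).
Proof.
move=> h0 t0.
have := primitive_comp (semigroup_bounded h0) (V_primitive x).
move=> /(@is_primitive_eq _ _ (fun t => S t (S h x))) p.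
apply: (primitive_unique (V_primitive (S h x)) (p _)) => // s s0 /=.
by rewrite -!semigroupD// addrC.
Qed.

Context (W : X -> X).
Hypothesis V_cvg : forall x (e : R), 0 < e -> exists2 K : R, 0 <= K &
  forall t, K <= t -> rnorm (V t x - W x) <= e.

(** The shift identity in the limit of large [t]; it makes the difference quotients at [W x]
    explicit. *)
Lemma limit_primitive_shift h x : 0 <= h -> S h (W x) = W x - V h x.
Proof.
move=> h0; apply/eqP; rewrite -subr_eq0; apply/eqP; apply: rnorm_le0 => e e0.
have bS := semigroup_bounded h0; have o0 := opnorm_ge0 bS.
have o1 : 0 < opnorm (S h) + 1 by rewrite ltr_wpDl.
have [|K K0 hK] := V_cvg x (e := e / 2 / (opnorm (S h) + 1)); first by rewrite !divr_gt0.
have [|K' K'0 hK'] := V_cvg x (e := e / 2); first by rewrite divr_gt0.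
pose t := K + K'; have t0 : 0 <= t by rewrite addr_ge0.
have -> : S h (W x) - (W x - V h x) = (V (t + h) x - W x) - S h (V t x - W x).
  have [_ _ SB _ _] := linear_opE (proj1 bS).
  rewrite SB semigroup_primitive_shift// !opprB [RHS]addrC -[RHS]addrA.
  by rewrite [X in _ = _ + X]addrA subrK.
rewrite (le_trans (rnormB _ _))// [e]splitr lerD ?hK'//.
  by rewrite /t -addrA addrCA lerDl addr_ge0.
rewrite (le_trans (opnormP _ bS))//.
have := hK t; rewrite lerDl => /(_ K'0); rewrite ler_pdivlMr//.
have := rnorm_ge0 (V t x - W x); nra.
Qed.

Lemma limit_primitive_comm h x : 0 <= h -> W (S h x) = S h (W x).
Proof.
move=> h0; apply/eqP; rewrite -subr_eq0; apply/eqP; apply: rnorm_le0 => e e0.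
have bS := semigroup_bounded h0; have o0 := opnorm_ge0 bS.
have o1 : 0 < opnorm (S h) + 1 by rewrite ltr_wpDl.
have [|K K0 hK] := V_cvg x (e := e / 2 / (opnorm (S h) + 1)); first by rewrite !divr_gt0.
have [|K' K'0 hK'] := V_cvg (S h x) (e := e / 2); first by rewrite divr_gt0.
pose t := K + K'; have t0 : 0 <= t by rewrite addr_ge0.
rewrite (le_trans (rdistD (V t (S h x)) _ _))// [e]splitr lerD//.
  by rewrite rdistC hK'// /t lerDr.
have [_ _ SB _ _] := linear_opE (proj1 bS).
rewrite semigroup_primitive_comm// -SB (le_trans (opnormP _ bS))//.
have := hK t; rewrite lerDl => /(_ K'0); rewrite ler_pdivlMr//.
have := rnorm_ge0 (V t x - W x); nra.
Qed.

Lemma limit_primitive_linear : linear W.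
Proof.
move=> a x y; apply/eqP; rewrite -subr_eq0; apply/eqP; apply: rnorm_le0 => e e0.
have o1 : 0 < rnorm (a : R[i]^o) + 1 by rewrite ltr_wpDl// rnorm_ge0.
have e3 : 0 < e / 3 by rewrite divr_gt0.
have [|K1 K10 h1] := V_cvg x (e := e / 3 / (rnorm (a : R[i]^o) + 1)).
  by rewrite divr_gt0.
have [K2 K20 h2] := V_cvg y e3; have [K3 K30 h3] := V_cvg (a *: x + y) e3.
pose t := K1 + K2 + K3; have t0 : 0 <= t by rewrite !addr_ge0.
rewrite (le_trans (rdistD (V t (a *: x + y)) _ _))//.
have {}h3 : rnorm (W (a *: x + y) - V t (a *: x + y)) <= e / 3.
  by rewrite rdistC h3// /t lerDr addr_ge0.
have {}h2 : rnorm (V t y - W y) <= e / 3.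
  by rewrite h2// /t addrAC lerDr addr_ge0.
have {}h1 := h1 t; rewrite /t -addrA lerDl addr_ge0// in h1.
move: (h1 isT); rewrite ler_pdivlMr// addrA -/t => {}h1.
move: h3; rewrite (proj1 (semigroup_primitive_bounded t0)) => h3.
have -> : a *: V t x + V t y - (a *: W x + W y) = a *: (V t x - W x) + (V t y - W y).
  by rewrite scalerBr opprD addrACA.
have := rnormD (a *: (V t x - W x)) (V t y - W y); rewrite rnormZ.
have := rnorm_ge0 (V t x - W x); nra.
Qed.

End Semigroup.

(** * The convergent Laplace integral is the resolvent *)

Section Resolvent.
Context {R : realType} (X : completeNormedModType R[i]) (T : R -> X -> X).
Hypothesis T_semigroup : C0_semigroup T.

(** The rescaled semigroup with generator [A - z]; its integral over [[0, +oo[] is the candidate for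
    the resolvent at [z]. *)
Definition damped (z : R[i]) (t : R) (x : X) : X := cexp (- z) t *: T t x.

Lemma dampedK z t x : cexp z t *: damped z t x = T t x.
Proof. by rewrite scalerA mulrC cexpN scale1r. Qed.

Lemma damped_semigroup z : C0_semigroup (damped z).
Proof.
split.
- move=> t t0; have [lT [M hM]] := semigroup_bounded T_semigroup t0.
  split.
    move=> a x y; rewrite /damped lT scalerDr !scalerA; congr (_ *: _ + _).
    by rewrite mulrC.
  exists (rnorm (cexp (- z) t : R[i]^o) * M) => v.
  by rewrite rnormZ -mulrA ler_wpM2l ?rnorm_ge0.
- by apply/funext => x; rewrite /damped cexp0 scale1r (semigroup0 T_semigroup).
- move=> s t s0 t0; apply/funext => x /=.
  have [_ _ _ _ TZ] := linear_opE (proj1 (semigroup_bounded T_semigroup s0)).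
  by rewrite /damped (semigroupD T_semigroup)// cexpD TZ scalerA.
move=> x; apply/within_continuousP => t t0 e e0.
have cu := semigroup_orbit T_semigroup x.
pose c : R := rnorm (cexp (- z) t : R[i]^o).
have c0 : 0 <= c by exact: rnorm_ge0.
have zz : 0 < rnorm (- z : R[i]^o) + 1 by rewrite ltr_wpDl// rnorm_ge0.
have e2 : 0 < e / 2 / (c + 1) by rewrite !divr_gt0// ltr_wpDl.
have [d1 d10 h1] := cu t t0 _ e2.
have [d2 d20 h2] := cu t t0 _ ltr01.
have [d3 d30 h3] := cexp_sub1 (- z).
pose m := rnorm (T t x) + 1.
have m0 : 0 < m by rewrite ltr_wpDl// rnorm_ge0.
pose d4 := e / 2 / (c + 1) / m / (rnorm (- z : R[i]^o) + 1).
have d40 : 0 < d4 by rewrite !divr_gt0// ltr_wpDl.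
exists (Num.min (Num.min d1 d2) (Num.min d3 d4)).
  by rewrite !lt_min d10 d20 d30.
move=> s s0; rewrite !lt_min => /andP[/andP[/(h1 _ s0) {}h1 /(h2 _ s0) {}h2]].
move=> /andP[/h3 {}h3 sd4].
have Tm : rnorm (T s x) <= m.
  by rewrite -(subrK (T t x) (T s x)) (le_trans (rnormD _ _))// addrC lerD2l.
(* Product rule: the exponential factor varies against [T s x], bounded by [m] near [t], and the
   orbit varies against a fixed scalar. *)
have -> : damped z s x - damped z t x =
   (cexp (- z) t * (cexp (- z) (s - t) - 1)) *: T s x +
   cexp (- z) t *: (T s x - T t x).
  rewrite mulrBr -cexpD mulr1 [t + _]addrC subrK /damped.
  by rewrite scalerBl scalerBr addrA subrK.
rewrite (le_trans (rnormD _ _))// [e]splitr lerD//.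
  rewrite rnormZ rnorm_complexM -/c.
  have : rnorm (cexp (- z) (s - t) - 1 : R[i]^o) * rnorm (T s x) <= e / 2 / (c + 1).
    rewrite (le_trans (ler_pM (rnorm_ge0 _) (rnorm_ge0 _) h3 Tm))//.
    move: sd4; rewrite /d4 ltr_pdivlMr// ltr_pdivlMr// => /ltW h.
    by rewrite [in leLHS](mulrC _ `|s - t|).
  rewrite ler_pdivlMr ?ltr_wpDl//.
  have := rnorm_ge0 (cexp (- z) (s - t) - 1 : R[i]^o); have := rnorm_ge0 (T s x).
  nra.
rewrite rnormZ -/c; move: h1; rewrite ler_pdivlMr ?ltr_wpDl//.
have := rnorm_ge0 (T s x - T t x); nra.
Qed.

Lemma generator_at_unique x y y' : generator_at T x y -> generator_at T x y' -> y = y'.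
Proof.
move=> /generator_atP g /generator_atP g'; apply/eqP; rewrite -subr_eq0; apply/eqP.
apply: rnorm_le0 => e e0; have e2 : 0 < e / 2 by rewrite divr_gt0.
have [d d0 h] := g _ e2; have [d' d'0 h'] := g' _ e2.
pose r := Num.min d d' / 2.
have md : 0 < Num.min d d' by rewrite lt_min d0.
have r0 : 0 < r by rewrite divr_gt0.
have rm : r < Num.min d d' by rewrite ltr_pdivrMr// ltr_pMr ?ltr1n.
move: (rm); rewrite lt_min => /andP[rd rd'].
rewrite (le_trans (rdistD ((r^-1)%:C%C *: (T r x - x)) _ _))// [e]splitr lerD ?h'//.
by rewrite rdistC h.
Qed.

Context (A : operator X) (z : R[i]) (V : R -> X -> X) (W : X -> X) (M : R).
Hypothesis A_generator : is_generator T A.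
Hypothesis V_primitive :
  forall x, is_primitive (fun t => damped z t x) (fun t => V t x).
Hypothesis V_cvg : forall x (e : R), 0 < e -> exists2 K : R, 0 <= K &
  forall t, K <= t -> rnorm (V t x - W x) <= e.
Hypothesis W_bounded : forall x, rnorm (W x) <= M * rnorm x.

Let W_linear : linear W := limit_primitive_linear (damped_semigroup z) V_primitive V_cvg.

(** [T h] is [cexp z h] times the damped semigroup, which sends [W x] to [W x - V h x]. To first
    order in [h] the exponential gives [z *: W x] and [V h x] gives [x]. *)
Lemma limit_primitive_generator x : generator_at T (W x) (z *: W x - x).
Proof.
apply/generator_atP => e e0.
pose w := rnorm (W x); have w0 : 0 <= w by exact: rnorm_ge0.
pose n := rnorm x; have n0 : 0 <= n by exact: rnorm_ge0.
pose k := rnorm (z : R[i]^o) + 1.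
have k0 : 0 < k by rewrite ltr_wpDl// rnorm_ge0.
have e3 : 0 < e / 3 by rewrite divr_gt0.
have e3w : 0 < e / 3 / (w + 1) by rewrite divr_gt0// ltr_wpDl.
have [d1 d10 h1] := cexp_derive0 z e3w.
have [d2 d20 h2] := cexp_sub1 z.
have [V0 /(_ 0 (lexx _))hV] := V_primitive x.
have [d3 d30 h3] := hV _ e3; have [d4 d40 h4] := hV _ ltr01.
(* This radius makes the cross term [(cexp z h - 1) *: V h x], of second order in [h], at most
   [h * (e / 3)]. *)
pose d5 := e / 3 / k / (n + 1); have d50 : 0 < d5 by rewrite !divr_gt0// ltr_wpDl.
exists (Num.min (Num.min (Num.min d1 d2) (Num.min d3 d4)) d5).
  by rewrite !lt_min d10 d20 d30 d40.
move=> h h0; rewrite !lt_min => /andP[/andP[/andP[hd1 hd2] /andP[hd3 hd4]] hd5].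
have hE : `|h| = h by rewrite gtr0_norm.
rewrite -hE in hd1 hd2.
have {}h1 := h1 _ hd1; have {}h2 := h2 _ hd2.
have := h3 h (ltW h0); have := h4 h (ltW h0).
rewrite !subr0 hE (semigroup0 (damped_semigroup z)) V0 subr0.
move=> /(_ hd4) {}h4 /(_ hd3) {}h3.
have Vh : rnorm (V h x) <= (n + 1) * h.
  have := rnormD (V h x - h%:C%C *: x) (h%:C%C *: x).
  by rewrite subrK rnormZr hE -/n => /le_trans; apply; lra.
rewrite -(dampedK z h (W x)).
rewrite (limit_primitive_shift (damped_semigroup z) V_primitive V_cvg _ (ltW h0)).
have hne : (h%:C%C : R[i]) != 0 by rewrite eq_complex /= gt_eqF.
have hinv : (h^-1)%:C%C * h%:C%C = 1 :> R[i].
  by rewrite -rmorphM /= mulVf ?gt_eqF.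
have -> : (h^-1)%:C%C *: (cexp z h *: (W x - V h x) - W x) - (z *: W x - x) =
  (h^-1)%:C%C *: ((cexp z h - 1 - h%:C%C * z) *: W x - (cexp z h - 1) *: V h x
     - (V h x - h%:C%C *: x)).
  have -> : z *: W x - x = (h^-1)%:C%C *: (h%:C%C *: (z *: W x - x)).
    by rewrite scalerA hinv scale1r.
  rewrite -scalerBr; congr (_ *: _).
  rewrite !scalerBl !scalerBr !scale1r !scalerA.
  have alg (a b p q r v : X) : a - b - p - (q - r) = a - p - q - (b - v) - (v - r).
    rewrite !opprB -[RHS]addrA [v - b + _]addrC [r - v + _]addrA subrK.
    by rewrite [a - b - p]addrAC [LHS]addrACA [RHS]addrACA [- b - q]addrC.
  exact: alg.
rewrite rnormZr gtr0_norm ?invr_gt0// ler_pdivrMl//.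
rewrite (le_trans (rnormB _ _))//.
have -> : h * e = (h * (e / 3) + h * (e / 3)) + (h * (e / 3)) by field.
rewrite lerD//; last by rewrite mulrC.
rewrite (le_trans (rnormB _ _))// lerD// rnormZ.
  rewrite -/w (le_trans (ler_wpM2r w0 h1))// hE.
  rewrite mulrAC [leRHS]mulrC ler_wpM2r ?(ltW h0)// mulrAC ler_pdivrMr ?ltr_wpDl//.
  by rewrite ler_wpM2l ?(ltW e3)// lerDl.
rewrite (le_trans (ler_pM (rnorm_ge0 _) (rnorm_ge0 _) h2 Vh))// hE -/k.
have n1 : 0 < n + 1 by rewrite ltr_wpDl.
move: hd5; rewrite /d5 ltr_pdivlMr// ltr_pdivlMr// => /ltW hd5.
have -> : k * h * ((n + 1) * h) = h * (h * (n + 1) * k) by ring.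
by rewrite ler_wpM2l// (ltW h0).
Qed.

(** The right inverse is the derivative just computed. For the left inverse, [W] commutes with
    [T h], so it maps the difference quotients at [x] to those at [W x]; their limits [W (op A x)]
    and [z *: W x - x] agree. *)
Lemma limit_primitive_resolvent : is_resolvent A z W.
Proof.
have bW : bounded_linear W by split; [|exists M].
have [_ _ WB _ WZ] := linear_opE W_linear.
have [domA opA] := A_generator.
have AW x : dom A (W x) /\ op A (W x) = z *: W x - x.
  have dW : dom A (W x).
    by rewrite domA; exists (z *: W x - x); exact: limit_primitive_generator.
  split=> //; apply: (generator_at_unique (opA _ dW)).
  exact: limit_primitive_generator.
split=> // [y|x dx].
  by have [dW ->] := AW y; split=> //; rewrite opprB addrC subrK.
rewrite WB WZ.
suff -> : W (op A x) = z *: W x - x by rewrite opprB addrC subrK.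
apply: (@generator_at_unique (W x)); last exact: limit_primitive_generator.
apply/generator_atP => e e0.
have M1 : 0 < `|M| + 1 by rewrite ltr_wpDl.
have eM : 0 < e / (`|M| + 1) by rewrite divr_gt0.
have /generator_atP/(_ _ eM)[d d0 hd] := opA x dx.
exists d => // h h0 hlt.
have TW : T h (W x) = W (T h x).
  rewrite -!(dampedK z h) WZ.
  by rewrite (limit_primitive_comm (damped_semigroup z) V_primitive V_cvg)// ltW.
rewrite TW -WB -WZ -WB (le_trans (W_bounded _))//.
have := hd h h0 hlt; rewrite ler_pdivlMr// => /(le_trans _); apply.
rewrite mulrC ler_wpM2l ?rnorm_ge0// (le_trans (ler_norm _))// lerDl//.
Qed.

End Resolvent.

(** * The weak integrability estimate *)

Section WeakEstimate.
Context {R : realType}.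
Local Notation mu := (@lebesgue_measure R).

(** The only link between the Lebesgue integral and the mean value inequality. [H t] is the integral
    of [g^p] over [[0, t]]; bounding its increments below by local lower bounds of [g] replaces
    differentiating it. *)
Lemma Lp_antiderivative (g : R -> R) (p : R) :
  (forall t, 0 <= g t) -> {within `[0, +oo[, continuous g} -> 0 <= p ->
  (\int[mu]_(t in `[0%R, +oo[) (g t `^ p)%:E < +oo)%E ->
  exists (H : R -> R) (K : R), [/\ 0 <= K,
    forall t, 0 <= H t <= K &
    forall t s m, 0 <= t -> t <= s -> 0 <= m ->
      (forall r, t <= r <= s -> m <= g r) -> m `^ p * (s - t) <= H s - H t].
Proof.
move=> g0 cg p0 fin.
pose h t := (g t `^ p)%:E.
have h0 t : (0 <= h t)%E by rewrite lee_fin powR_ge0.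
have mI (i : interval R) : measurable [set` i] by exact: measurable_itv.
have mh : measurable_fun (`[0, +oo[%classic : set R) h.
  apply/measurable_EFinP.
  apply: (measurableT_comp (measurable_powR p)).
  exact: subspace_continuous_measurable_fun.
have sub0 (i : interval R) : (BLeft 0 <= i.1)%O -> [set` i] `<=` (`[0, +oo[%classic : set R).
  case: i => i1 i2 /= i10 x /=; rewrite !itv_boundlr /= andbT => /andP[+ _].
  exact: le_trans.
have mhi (i : interval R) : (BLeft 0 <= i.1)%O -> measurable_fun [set` i] h.
  by move=> /sub0 i0; apply: measurable_funS mh.
have int0 D : (0 <= \int[mu]_(t in D) h t)%E by exact: integral_ge0.
pose I := (\int[mu]_(t in `[0%R, +oo[) h t)%E.
have finI : I \is a fin_num by rewrite ge0_fin_numE// int0.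
have leI (i : interval R) : (BLeft 0 <= i.1)%O -> (\int[mu]_(t in [set` i]) h t <= I)%E.
  by move=> i0; apply: ge0_subset_integral => //; exact: sub0.
have fini (i : interval R) : (BLeft 0 <= i.1)%O ->
    (\int[mu]_(t in [set` i]) h t)%E \is a fin_num.
  by move=> i0; rewrite ge0_fin_numE// (le_lt_trans (leI i i0)).
exists (fun t => fine (\int[mu]_(r in `[0%R, t]) h r)%E), (fine I); split.
- exact/fine_ge0/int0.
- move=> t; apply/andP; split; first exact/fine_ge0/int0.
  by apply: fine_le => //; [exact: fini|exact: leI].
move=> t s m t0 ts m0 mg.
have E : (\int[mu]_(r in `[0%R, s]) h r =
    \int[mu]_(r in `[0%R, t]) h r + \int[mu]_(r in `]t, s]) h r)%E.
  have U : `[0, s]%classic = `[0, t]%classic `|` `]t, s]%classic.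
    by apply: itv_bndbnd_setU; rewrite bnd_simp.
  rewrite U ge0_integral_setU//.
    by rewrite -U; exact: mhi.
  apply/disj_setPS => x [] /=; rewrite !in_itv /= => /andP[_ xt] /andP[tx _].
  by move: tx; rewrite ltNge xt.
have t0' : (BLeft 0 <= BRight t)%O by rewrite bnd_simp.
rewrite E fineD ?fini// [leRHS]addrAC subrr add0r -lee_fin fineK ?fini//.
have -> : ((m `^ p * (s - t))%:E = \int[mu]_(r in `]t, s]) (cst (m `^ p)%:E) r)%E.
  rewrite integral_cst//= lebesgue_measure_itv/= lte_fin EFinM.
  case: ltP => // st; have -> : s = t by apply/eqP; rewrite eq_le st.
  by rewrite subrr.
apply: ge0_le_integral => //.
- by move=> x _; rewrite lee_fin powR_ge0.
- exact: mhi.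
move=> x /=; rewrite in_itv /= => /andP[tx xs]; rewrite lee_fin.
by rewrite ge0_ler_powR ?nnegrE// mg// (ltW tx).
Qed.

(* Below [eta], bound [g] by [eta]; above it, [g] is at most [eta (g / eta)^p]. *)
Lemma le_add_powR (g eta p : R) : 0 <= g -> 0 < eta -> 1 <= p ->
  g <= eta + eta `^ (1 - p) * g `^ p.
Proof.
move=> g0 eta0 p1; have [ge|eg] := leP g eta.
  by rewrite (le_trans ge)// lerDl mulr_ge0 ?powR_ge0.
pose q := g / eta; have q1 : 1 <= q by rewrite ler_pdivlMr// mul1r ltW.
have gE : g = eta * q by rewrite /q mulrC divfK// gt_eqF.
have q0 : 0 <= q by rewrite (le_trans _ q1).
rewrite [in leRHS]gE powRM ?(ltW eta0)// mulrA -powRD; last first.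
  by rewrite (gt_eqF eta0) implybT.
rewrite subrK powRr1 ?(ltW eta0)// [leLHS]gE ler_wpDl ?(ltW eta0)//.
by rewrite ler_wpM2l ?(ltW eta0)// le1r_powR.
Qed.

(** A first-order form, with explicit remainder, of the fact that [e^{-d t}] is the derivative of
    [- e^{-d t} / d]. Convexity gives it without remainder when [s <= t]. *)
Lemma expR_increment (d s t : R) : 0 < d -> 0 <= s -> 0 <= t ->
  expR (- (d * t)) * `|s - t| <=
    `|expR (- (d * s)) - expR (- (d * t))| / d + d * `|s - t| ^+ 2.
Proof.
move=> d0.
have main x y : 0 <= x -> x <= y ->
    expR (- (d * y)) * (y - x) <= (expR (- (d * x)) - expR (- (d * y))) / d.
  move=> x0 xy; rewrite ler_pdivlMr//.
  have -> : - (d * x) = - (d * y) + d * (y - x) by ring.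
  rewrite expRD -{3}[expR _]mulr1 -mulrBr -mulrA ler_wpM2l ?expR_ge0//.
  by rewrite lerBrDl mulrC expR_ge1Dx.
move=> s0 t0; have [st|/ltW ts] := leP s t.
  rewrite distrC (ger0_norm (x := t - s)) ?subr_ge0// ger0_norm; last first.
    by rewrite subr_ge0 ler_expR lerN2 ler_wpM2l// ltW.
  by rewrite (le_trans (main s t s0 st))// lerDl mulr_ge0 ?exprn_ge0 ?subr_ge0 ?(ltW d0).
rewrite (ger0_norm (x := s - t)) ?subr_ge0// distrC ger0_norm; last first.
  by rewrite subr_ge0 ler_expR lerN2 ler_wpM2l// ltW.
rewrite -lerBlDr (le_trans _ (main t s t0 ts))//.
rewrite expr2 mulrA -mulrBl ler_wpM2r ?subr_ge0//.
have -> : - (d * s) = - (d * t) + - (d * (s - t)) by ring.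
have e1 : expR (- (d * t)) <= 1 by rewrite -expR0 ler_expR oppr_le0 mulr_ge0// ltW.
have := expR_ge1Dx (- (d * (s - t))); have := expR_ge0 (- (d * t)).
have : 0 <= d * (s - t) by rewrite mulr_ge0 ?subr_ge0 ?(ltW d0).
rewrite expRD; nra.
Qed.

End WeakEstimate.

Section WeakLp.
Context {R : realType} (X : completeNormedModType R[i]) (T : R -> X -> X).
Hypothesis T_semigroup : C0_semigroup T.

(** For [t >= a] the integrand is at most [E a * E t * g t]. It is dominated to first order by the
    increments of [G = E a * theta * (H - E)], whose total increase is at most
    [E a * theta * (K + 1)] because [H] stays in [[0, K]] and [E] in [[0, 1]]. *)
Lemma weak_Lp_estimate (x : X) (f : X -> R[i]^o) (p : R) : bounded_linear f -> 1 <= p ->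
  (\int[@lebesgue_measure R]_(t in `[0%R, +oo[) (rnorm (f (T t x)) `^ p)%:E < +oo)%E ->
  exists2 K : R, 0 <= K & forall (z : R[i]) (d a b : R) (V : R -> X),
    0 < d -> d <= 1 -> 2 * d <= complex.Re z ->
    is_primitive (fun t => damped T z t x) V -> 0 <= a -> a <= b ->
    rnorm (f (V b - V a)) <= expR (- (d * a)) * ((1 + K) * d `^ (p^-1 - 1)).
Proof.
move=> bf p1 fin; pose g t := rnorm (f (T t x)).
have p0 : 0 < p by rewrite (lt_le_trans _ p1).
have g0 t : 0 <= g t by exact: rnorm_ge0.
have [_ _ fB _ fZ] := linear_opE (proj1 bf).
have gC t : 0 <= t -> forall e : R, 0 < e -> exists2 r : R, 0 < r &
    forall s, 0 <= s -> `|s - t| < r -> `|g s - g t| <= e.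
  move=> t0 e e0; have o1 : 0 < opnorm f + 1 by rewrite ltr_wpDl// opnorm_ge0.
  have [|r r0 hr] := semigroup_orbit T_semigroup x t0 (e := e / (opnorm f + 1)).
    by rewrite divr_gt0.
  exists r => // s s0 st.
  have h : rnorm (f (T s x) - f (T t x)) <= e.
    rewrite -fB (le_trans (opnormP _ bf))//; have := hr s s0 st.
    rewrite ler_pdivlMr//; have := rnorm_ge0 (T s x - T t x); nra.
  rewrite (le_trans _ h)// ler_norml; apply/andP; split.
    have := rdistD (f (T s x)) (f (T t x)) 0; rewrite !subr0 rdistC -/(g t) -/(g s); lra.
  have := rdistD (f (T t x)) (f (T s x)) 0; rewrite !subr0 -/(g t) -/(g s); lra.
have cg : {within `[0, +oo[, continuous g}.
  apply/subspace_continuousP => t /=; rewrite in_itv /= andbT => t0.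
  apply/cvgrPdist_le => e e0; have [r r0 hr] := gC t t0 e e0.
  exists r => //= s /= st; rewrite in_itv /= andbT => s0.
  by rewrite distrC hr// distrC.
have [H [K [K0 HK incH]]] := Lp_antiderivative g0 cg (ltW p0) fin.
exists K => // z d a b V d0 d1 dz pV a0 ab.
(* This [eta] balances the two contributions: [eta / d], from integrating the constant against
   [e^{-d t}], and [eta^(1 - p)], the weight of [g^p], both equal [theta]. *)
pose eta := d `^ p^-1; pose theta := d `^ (p^-1 - 1).
have eta0 : 0 < eta by exact: powR_gt0.
have theta0 : 0 < theta by exact: powR_gt0.
have eta1 : eta <= 1.
  rewrite -(powRr0 d); apply: ger_powR; first by rewrite d0.
  by rewrite invr_ge0 ltW.
have thetaE : eta `^ (1 - p) = theta.
  by rewrite /eta -powRrM /theta mulrBr mulr1 mulVf// gt_eqF.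
have etad : eta = theta * d.
  rewrite /theta powRD; last by rewrite (gt_eqF d0) implybT.
  by rewrite powR_inv1 ?(ltW d0)// divfK// gt_eqF.
pose E t := expR (- (d * t)).
have E0 t : 0 <= E t by exact: expR_ge0.
have E1 t : 0 <= t -> E t <= 1.
  by move=> t0; rewrite /E -expR0 ler_expR oppr_le0 mulr_ge0// ltW.
have Emono s t : s <= t -> E t <= E s.
  by move=> st; rewrite ler_expR lerN2 ler_wpM2l// ltW.
have Hmono s t : 0 <= s -> s <= t -> H s <= H t.
  move=> s0 st; have := incH s t 0 s0 st (lexx _) (fun r _ => g0 r).
  have : 0 <= 0 `^ p * (t - s) by rewrite mulr_ge0 ?powR_ge0 ?subr_ge0.
  lra.
have ct0 : 0 <= E a * theta by rewrite mulr_ge0// ltW.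
pose G t := E a * theta * (H t - E t).
have Gmono s t : a <= s -> s <= t -> t <= b -> G s <= G t.
  move=> as_ st _; rewrite ler_wpM2l// lerB ?Emono// Hmono//.
  exact: le_trans as_.
have Ginc s t : 0 <= s -> 0 <= t ->
    E a * theta * (`|E s - E t| + `|H s - H t|) <= `|G s - G t|.
  move=> s0 t0; rewrite -mulrBr normrM (ger0_norm ct0) ler_wpM2l//.
  have [st|/ltW ts] := leP s t.
    rewrite (distrC (H s)) (distrC _ (H t - E t)).
    rewrite !ger0_norm ?subr_ge0 ?Emono ?Hmono//; first lra.
    by rewrite lerB ?Emono ?Hmono.
  rewrite (distrC (E s)).
  rewrite !ger0_norm ?subr_ge0 ?Emono ?Hmono//; first lra.
  by rewrite lerB ?Emono ?Hmono.
have loc t : a <= t <= b -> forall e : R, 0 < e -> exists2 r : R, 0 < r &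
     forall s, a <= s <= b -> `|s - t| < r ->
       rnorm ((f \o (fun t => damped T z t x)) t) * `|s - t| <= `|G s - G t| + e * `|s - t|.
  move=> /andP[at_ tb] e e0; have t0 := le_trans a0 at_.
  have e2 : 0 < e / 2 by rewrite divr_gt0.
  have [r r0 hr] := gC t t0 _ e2.
  (* The bound [e / 2] on [|s - t|] absorbs the quadratic remainder of [expR_increment], as
     [eta * d <= 1]. *)
  exists (Num.min r (e / 2)); first by rewrite lt_min r0.
  move=> s /andP[as_ sb]; rewrite lt_min => /andP[sr /ltW se].
  have s0 := le_trans a0 as_.
  set D := `|s - t| in se *; have D0 : 0 <= D by exact: normr_ge0.
  (* A nonnegative lower bound for [g] near [t] that loses at most [e / 2] against [g t]. *)
  pose m := Num.max 0 (g t - e / 2).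
  have m0 : 0 <= m by rewrite le_max lexx.
  have gm u : 0 <= u -> `|u - t| < r -> m <= g u.
    move=> u0 /(hr u u0); rewrite ler_norml ge_max g0 /= => /andP[+ _]; lra.
  have hH : m `^ p * D <= `|H s - H t|.
    rewrite /D; have [st|/ltW ts] := leP s t.
      rewrite distrC (distrC (H s)) !ger0_norm ?subr_ge0 ?Hmono//.
      apply: incH => // u /andP[su ut]; apply: gm; first exact: le_trans su.
      rewrite (le_lt_trans _ sr)// distrC (distrC s) !ger0_norm ?subr_ge0//.
      by rewrite lerB.
    rewrite !ger0_norm ?subr_ge0 ?Hmono//.
    apply: incH => // u /andP[tu us]; apply: gm; first exact: le_trans tu.
    by rewrite (le_lt_trans _ sr)// !ger0_norm ?subr_ge0// lerB.
  have hY : g t <= e / 2 + (eta + theta * m `^ p).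
    have := le_add_powR m0 eta0 p1; rewrite thetaE.
    have : g t - e / 2 <= m by rewrite le_max lexx orbT.
    lra.
  have hE : E t * D <= `|E s - E t| / d + d * D ^+ 2 by exact: expR_increment.
  have hf : rnorm (f (damped T z t x)) <= E a * E t * g t.
    rewrite /damped fZ rnormZ rnorm_cexp (ler_wpM2r (g0 t))// /E -expRD ler_expR.
    have -> : complex.Re (- z) = - complex.Re z by case: (z).
    have : complex.Re z * t >= 2 * d * t by rewrite ler_wpM2r.
    have : d * a <= d * t by rewrite ler_wpM2l// ltW.
    lra.
  rewrite /= (le_trans (ler_wpM2r D0 hf))//.
  have -> : E a * E t * g t * D = E a * (E t * g t * D) by ring.
  have hE' : eta * (E t * D) <= theta * `|E s - E t| + e / 2 * D.
    rewrite (le_trans (ler_wpM2l (ltW eta0) hE))// mulrDr lerD//.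
      by rewrite etad -mulrA (mulrCA d) divff ?gt_eqF// mulr1.
    rewrite expr2 !mulrA ler_wpM2r// (le_trans _ se)//.
    have : eta * d <= 1 by rewrite mulr_ile1 ?(ltW eta0) ?(ltW d0).
    nra.
  have h1 : E t * g t * D <= theta * (`|E s - E t| + `|H s - H t|) + e * D.
    have k1 : E t * g t * D <= E t * (e / 2 + (eta + theta * m `^ p)) * D.
      by rewrite ler_wpM2r// ler_wpM2l.
    have k2 : E t * (m `^ p * D) <= `|H s - H t|.
      by rewrite (le_trans _ hH)// ler_piMl ?E1// mulr_ge0 ?powR_ge0.
    have k3 := ler_wpM2l (ltW theta0) k2.
    have k4 : E t * (e / 2 * D) <= e / 2 * D.
      by rewrite ler_piMl ?E1// mulr_ge0// ltW.
    rewrite (le_trans k1)//.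
    have -> : E t * (e / 2 + (eta + theta * m `^ p)) * D =
      E t * (e / 2 * D) + eta * (E t * D) + theta * (E t * (m `^ p * D)) by ring.
    have -> : e * D = e / 2 * D + e / 2 * D by field.
    rewrite mulrDr; lra.
  rewrite (le_trans (ler_wpM2l (E0 a) h1))// mulrDr lerD//.
    by rewrite mulrA Ginc.
  by rewrite ler_piMl ?E1// mulr_ge0// ltW.
rewrite fB (le_trans (primitive_bound (primitive_comp bf pV) a0 ab Gmono loc))//.
rewrite /G -mulrBr -/(E a) -/theta [(1 + K) * _]mulrC mulrA ler_wpM2l//.
have /andP[Ha0 _] := HK a; have /andP[_ HbK] := HK b.
have := E1 a a0; have := E0 b; lra.
Qed.

End WeakLp.

(** * Perturbation of the resolvent *)

Section Neumann.
Context {R : realType} (X : completeNormedModType R[i]).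

Section HalfContraction.
Context (L : X -> X).
Hypothesis L_linear : linear L.
Hypothesis L_half : forall x, rnorm (L x) <= 2^-1 * rnorm x.

Lemma half_contraction_bound w : rnorm w <= 2 * rnorm (w - L w).
Proof.
have := rdistD (L w) w 0; rewrite !subr0; have := L_half w; lra.
Qed.

Lemma half_contraction_inj v w : v - L v = w - L w -> v = w.
Proof.
have [_ _ LB _ _] := linear_opE L_linear.
move=> vw; apply/eqP; rewrite -subr_eq0; apply/eqP; apply: rnorm0_eq0.
have := half_contraction_bound (v - w).
rewrite LB subrACA vw subrr rnorm0 mulr0 => h.
by apply/eqP; rewrite eq_le h rnorm_ge0.
Qed.

(** Picard iteration of [w = y + L w] from 0; successive tails shrink by a factor 2. *)
Lemma half_contraction_surj y : exists w, w - L w = y.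
Proof.
have [L0 LD LB _ _] := linear_opE L_linear.
pose w := fix w n := if n is n'.+1 then y + L (w n') else 0.
have wb k : rnorm (w k) <= 2 * rnorm y.
  elim: k => [|k IH] /=; first by rewrite rnorm0 mulr_ge0// rnorm_ge0.
  have := rnormD y (L (w k)); have := L_half (w k); lra.
have wd n k : rnorm (w (n + k)%N - w n) <= (2 ^+ n)^-1 * (2 * rnorm y).
  elim: n => [|n IH]; first by rewrite expr0 invr1 mul1r subr0.
  rewrite addSn /= opprD addrACA subrr add0r -LB (le_trans (L_half _))//.
  by rewrite exprS invfM -mulrA ler_wpM2l ?invr_ge0.
have y1 : 0 < 2 * rnorm y + 1 by rewrite ltr_wpDl// mulr_ge0// rnorm_ge0.
have small (e : R) : 0 < e -> exists K : nat, (2 ^+ K)^-1 * (2 * rnorm y) <= e.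
  move=> e0; have [|K hK] := @invS_small R (e / (2 * rnorm y + 1)).
    by rewrite divr_gt0.
  exists K; have := hK K (leqnn _); rewrite ler_pdivlMr// => h.
  rewrite (le_trans _ h)// ler_pM ?invr_ge0 ?exprn_ge0 ?mulr_ge0 ?rnorm_ge0//.
    by rewrite lef_pV2 ?posrE ?exprn_gt0// -natrX ler_nat ltn_expl.
  by rewrite lerDl.
have [|l wl] := @rcauchy_cvg R X w.
  move=> e e0; have e2 : 0 < e / 2 by rewrite divr_gt0.
  have [K hK] := small _ e2.
  exists K => m n Km Kn; rewrite (le_trans (rdistD (w K) _ _))// [e]splitr lerD//.
    by rewrite -(subnKC Km) (le_trans (wd _ _)).
  by rewrite rdistC -(subnKC Kn) (le_trans (wd _ _)).
exists l; apply/eqP; rewrite -subr_eq0; apply/eqP; apply: rnorm_le0 => e e0.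
have e2 : 0 < e / 2 by rewrite divr_gt0.
have [K hK] := wl _ e2.
have -> : l - L l - y = L (w K - l) - (w K.+1 - l).
  by rewrite /= LB opprB [RHS]addrC opprD !addrA subrK addrAC.
rewrite (le_trans (rnormB _ _))// [e]splitr lerD ?hK//.
have := L_half (w K - l); have := hK K (leqnn _); have := rnorm_ge0 (w K - l).
lra.
Qed.

End HalfContraction.

(** On the domain, [z - c - A = (1 - c W) (z - A)], so the new resolvent is [W] composed with the
    inverse [J] of the half contraction perturbation [1 - c W]. *)
Lemma resolvent_perturbation (A : operator X) (z c : R[i]) (W : X -> X) (q : R) :
  is_resolvent A z W -> 0 <= q -> (forall x, rnorm (W x) <= q * rnorm x) ->
  rnorm (c : R[i]^o) * q <= 2^-1 ->
  exists2 B, is_resolvent A (z - c) B & forall x, rnorm (B x) <= 2 * q * rnorm x.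
Proof.
move=> [[W_lin _] WA AW] q0 Wq cq.
have [W0 WD WB _ WZ] := linear_opE W_lin.
pose L x := c *: W x.
have L_lin : linear L.
  by move=> a x y; rewrite /L W_lin scalerDr !scalerA mulrC.
have L_half x : rnorm (L x) <= 2^-1 * rnorm x.
  rewrite /L rnormZ (le_trans (ler_wpM2l (rnorm_ge0 _) (Wq x)))// mulrA.
  by rewrite ler_wpM2r// rnorm_ge0.
have [J hJ] := choice (half_contraction_surj L_lin L_half).
have [_ LD _ _ LZ] := linear_opE L_lin.
have J_lin : linear J.
  move=> a x y; apply: (half_contraction_inj L_lin L_half).
  by rewrite hJ LD LZ opprD addrACA -scalerBr !hJ.
have Jb y : rnorm (J y) <= 2 * rnorm y.
  by have := half_contraction_bound L_half (J y); rewrite hJ.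
have Bb x : rnorm ((W \o J) x) <= 2 * q * rnorm x.
  by rewrite /= (le_trans (Wq _))// [2 * q]mulrC -mulrA ler_wpM2l.
exists (W \o J) => //; split.
- split; last by exists (2 * q).
  by move=> a x y /=; rewrite J_lin W_lin.
- move=> y; have [dW hW] := WA (J y); split=> //=.
  by rewrite scalerBl addrAC hW; exact: hJ.
move=> x dx /=; rewrite -[RHS](AW x dx); congr (W _).
apply: (half_contraction_inj L_lin L_half).
by rewrite hJ /L AW// scalerBl addrAC.
Qed.

Lemma resolvent_eq (A : operator X) (z : R[i]) (B : X -> X) :
  is_resolvent A z B -> resolvent z A = B.
Proof.
move=> hB; have [_ _ BA] := hB.
have [_ RA _] : is_resolvent A z (resolvent z A) by apply: (xgetPex _ (ex_intro _ _ hB)).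
by apply/funext => y; have [d h] := RA y; rewrite -[in RHS]h BA.
Qed.

End Neumann.

Lemma le_expR_inv (R : realType) (x : R) : 0 < x -> expR (- x) <= x^-1.
Proof.
move=> x0; rewrite expRN lef_pV2 ?posrE ?expR_gt0//.
by rewrite (le_trans _ (expR_ge1Dx x))// lerDr.
Qed.

(** * Uniform resolvent bounds under weak integrability *)

Section WeakStability.
Context {R : realType} (X : completeNormedModType R[i]).
Context (T : R -> X -> X) (A : operator X) (E : set (X -> R[i]^o)).
Hypothesis T_semigroup : C0_semigroup T.
Hypothesis A_generator : is_generator T A.
Hypothesis E_subspace : dual_subspace E.
Hypothesis E_closed : dual_closed E.
Hypothesis E_norming : almost_norming E.
Hypothesis T_weakLp : forall (x : X) (x' : X -> R[i]^o), E x' ->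
  exists2 p : R, 1 <= p &
    (\int[@lebesgue_measure R]_(t in `[0%R, +oo[)
       (rnorm (x' (T t x)) `^ p)%:E < +oo)%E.

Lemma damped_primitives : exists V : R[i] -> R -> X -> X,
  forall z x, is_primitive (fun t => damped T z t x) (fun t => V z t x).
Proof.
have ex (q : R[i] * X) : exists U, is_primitive (fun t => damped T q.1 t q.2) U.
  exact/primitive_exists/(semigroup_orbit (damped_semigroup T_semigroup q.1)).
have [U hU] := choice ex.
by exists (fun z t x => U (z, x) t) => z x; exact: (hU (z, x)).
Qed.

Context (V : R[i] -> R -> X -> X).
Hypothesis V_primitive :
  forall z x, is_primitive (fun t => damped T z t x) (fun t => V z t x).

(** The index of the Baire argument is the whole quadruple [(z, d, a, b)], so [n] and [C] depend on
    none of them; this is what later allows [d] to be chosen in terms of [n] and [C]. *)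
Lemma damped_primitive_bound : exists (n : nat) (C : R), 0 <= C /\
  forall (z : R[i]) (d a b : R) x,
    0 < d -> d <= 1 -> 2 * d <= complex.Re z -> 0 <= a -> a <= b ->
    rnorm (V z b x - V z a x) <=
      C * (n.+1%:R * expR (- (d * a)) * d `^ (n.+1%:R^-1 - 1)) * rnorm x.
Proof.
pose P (i : R[i] * R * R * R) := let: (z, d, a, b) := i in
  [/\ 0 < d, d <= 1, 2 * d <= complex.Re z, 0 <= a & a <= b].
pose S (i : R[i] * R * R * R) (x : X) := let: (z, d, a, b) := i in
  V z b x - V z a x.
pose w (n : nat) (i : R[i] * R * R * R) := let: (z, d, a, b) := i in
  n.+1%:R * expR (- (d * a)) * d `^ (n.+1%:R^-1 - 1).
have [||n [C [C0 h]]] :=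
    @bilinear_baire R X E E_subspace E_closed E_norming _ P S w; last first.
- exists n, C; split=> // z d a b x d0 d1 dz a0 ab.
  by apply: (h (z, d, a, b) x).
- move=> x f Ef; have [p p1 fin] := T_weakLp x Ef.
  have [K K0 hK] := weak_Lp_estimate T_semigroup
    (dual_subspace_bounded E_subspace Ef) p1 fin.
  (* [n + 1] replaces both [p] and [1 + K]; enlarging [p] increases [d^(1/p - 1)] because
     [d <= 1]. *)
  pose n := (Num.truncn (Num.max p (1 + K))).+1.
  have : Num.max p (1 + K) <= n.+1%:R.
    by rewrite (le_trans (ltW (truncnS_gt _)))// ler_nat.
  rewrite ge_max => /andP[pn Kn].
  exists n => -[[[z d] a] b] [d0 d1 dz a0 ab] /=.
  rewrite (le_trans (hK z d a b (fun t => V z t x) d0 d1 dz _ a0 ab))//.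
  rewrite [leRHS]mulrAC mulrC ler_wpM2r ?expR_ge0//.
  rewrite ler_pM ?addr_ge0 ?powR_ge0//.
  apply: ger_powR; first by rewrite d0.
  by rewrite lerD2r lef_pV2 ?posrE// (lt_le_trans _ p1).
move=> [[[z d] a] b] [d0 d1 dz a0 ab].
have bV t : 0 <= t -> bounded_linear (V z t).
  exact: (semigroup_primitive_bounded (damped_semigroup T_semigroup z) (V_primitive z)).
by apply: bounded_linearD; [exact/bV/(le_trans a0)|exact/bounded_linearN/bV].
Qed.

(** The increment bound plays two roles: for large [a] its decay gives the Cauchy property of
    [V z t x], and at [a = 0] it gives the norm bound of the limit. *)
Lemma resolvent_right_half_plane : exists2 d : R, 0 < d &
  forall z, 2 * d <= complex.Re z ->
    exists2 W, is_resolvent A z W & forall x, rnorm (W x) <= (8 * d)^-1 * rnorm x.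
Proof.
have [n [C [C0 hV]]] := damped_primitive_bound.
(* With [d = c^-(n + 1)] the factor [d^(1/(n + 1))] equals [1/c], and [C (n + 1) / c <= 1/8]; the
   added 1 ensures [c >= 1], hence [d <= 1]. *)
pose c := 8 * (C * n.+1%:R) + 1.
have c1 : 1 <= c by rewrite lerDr !mulr_ge0.
have c0 : 0 < c by rewrite (lt_le_trans _ c1).
pose d := (c ^+ n.+1)^-1.
have d0 : 0 < d by rewrite invr_gt0 exprn_gt0.
have d1 : d <= 1 by rewrite invf_le1 ?exprn_gt0// exprn_ege1.
have dV0 : 0 < d^-1 by rewrite invr_gt0.
have dn : d `^ n.+1%:R^-1 = c^-1.
  rewrite /d -exprVn -powR_mulrn ?invr_ge0 ?(ltW c0)// -powRrM divff//.
  by rewrite powRr1// invr_ge0 ltW.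
have q : C * (n.+1%:R * d `^ (n.+1%:R^-1 - 1)) <= (8 * d)^-1.
  rewrite powRD; last by rewrite (gt_eqF d0) implybT.
  rewrite dn powR_inv1 ?(ltW d0)// invfM !mulrA (ler_wpM2r (ltW dV0))//.
  rewrite ler_pdivrMr// /c; lra.
exists d => // z dz.
have bnd a b x : 0 <= a -> a <= b ->
    rnorm (V z b x - V z a x) <= expR (- (d * a)) * ((8 * d)^-1 * rnorm x).
  move=> a0 ab; rewrite (le_trans (hV z d a b x d0 d1 dz a0 ab))//.
  rewrite [leRHS]mulrA ler_wpM2r ?rnorm_ge0//.
  rewrite [_ * expR _]mulrC -(mulrA (expR _)) (mulrCA C).
  by rewrite ler_wpM2l ?expR_ge0.
have V0 x : V z 0 x = 0 by case: (V_primitive z x).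
have bnd0 t x : 0 <= t -> rnorm (V z t x) <= (8 * d)^-1 * rnorm x.
  by move=> t0; have := bnd 0 t x (lexx _) t0; rewrite V0 subr0 mulr0 oppr0 expR0 mul1r.
have small x (e : R) : 0 < e -> exists K : nat, forall a b, K%:R <= a -> a <= b ->
    rnorm (V z b x - V z a x) <= e.
  move=> e0; pose B := (8 * d)^-1 * rnorm x.
  have B0 : 0 <= B by rewrite mulr_ge0 ?rnorm_ge0// invr_ge0 mulr_ge0// ltW.
  have de : 0 < d * e by rewrite mulr_gt0.
  exists (Num.truncn (B / (d * e))).+1 => a b Ka ab.
  have a0 : 0 < a by rewrite (lt_le_trans _ Ka).
  rewrite (le_trans (bnd a b x (ltW a0) ab))// -/B.
  have da : 0 < d * a by rewrite mulr_gt0.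
  rewrite (le_trans (ler_wpM2r B0 (le_expR_inv da)))// ler_pdivrMl//.
  rewrite mulrAC -ler_pdivrMl// mulrC.
  by rewrite (le_trans _ Ka)// ltW// truncnS_gt.
have lim x : exists l, cvg_for (@rnorm R X) (fun n => V z n%:R x) l.
  apply: rcauchy_cvg => e e0; have [K hK] := small x e e0.
  exists K => m k Km Kk.
  have [mk|/ltnW km] := leqP m k; last by apply: hK; rewrite ler_nat.
  by rewrite rdistC; apply: hK; rewrite ler_nat.
have [W hW] := choice lim.
have VW x (e : R) : 0 < e -> exists2 K : R, 0 <= K &
    forall t, K <= t -> rnorm (V z t x - W x) <= e.
  move=> e0; have e2 : 0 < e / 2 by rewrite divr_gt0.
  have [K1 h1] := small x _ e2; have [K2 h2] := hW x _ e2.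
  (* [W] is a limit along integers only; the increment bound carries it over to real [t]. *)
  exists (maxn K1 K2)%:R => // t Kt.
  rewrite (le_trans (rdistD (V z (maxn K1 K2)%:R x) _ _))// [e]splitr lerD//.
    by apply: h1 => //; rewrite ler_nat leq_maxl.
  by rewrite h2// leq_maxr.
have Wq x : rnorm (W x) <= (8 * d)^-1 * rnorm x.
  apply/ler_addgt0Pr => e e0; have [K K0 hK] := VW x e e0.
  have := hK K (lexx _); rewrite rdistC => h.
  rewrite -[W x](subrK (V z K x)) (le_trans (rnormD _ _))// addrC lerD//.
  exact: bnd0.
exists W => //.
exact: (limit_primitive_resolvent T_semigroup A_generator (V_primitive z) VW Wq).
Qed.

End WeakStability.

Theorem theorem5p1 (R : realType) (X : completeNormedModType R[i])
    (T : R -> X -> X) (A : operator X) (E : set (X -> R[i]^o))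
    (T_semigroup : C0_semigroup T)
    (A_generator : is_generator T A)
    (E_subspace : dual_subspace E)
    (E_closed : dual_closed E)
    (E_norming : almost_norming E)
    (T_weakLp : forall (x : X) (x' : X -> R[i]^o), E x' ->
       exists2 p : R, 1 <= p &
         (\int[@lebesgue_measure R]_(t in `[0%R, +oo[)
            (rnorm (x' (T t x)) `^ p)%:E < +oo)%E) :
  (s0 A < 0)%E.
Proof.
have [V hV] := damped_primitives T_semigroup.
have [d d0 res] := resolvent_right_half_plane T_semigroup A_generator
  E_subspace E_closed E_norming T_weakLp hV.
have q0 : 0 <= (8 * d)^-1 by rewrite invr_ge0 mulr_ge0// ltW.
have ext z : - d <= complex.Re z -> exists2 B, is_resolvent A z B &
    forall x, rnorm (B x) <= 2 * (8 * d)^-1 * rnorm x.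
  (* The shift by [3 d] takes [Re z >= - d] to [Re z >= 2 d], and [3 d / (8 d) = 3/8] is below the
     threshold 1/2 of the perturbation lemma. *)
  move=> dz; pose c : R[i] := (3 * d)%:C%C.
  have [|W rW Wq] := res (z + c).
    by rewrite raddfD /=; lra.
  have [|B] := resolvent_perturbation (c := c) rW q0 Wq.
    rewrite rnorm_real gtr0_norm ?mulr_gt0// invfM mulrACA divff ?gt_eqF// mulr1.
    by rewrite ler_pdivrMr//; lra.
  by rewrite addrK => rB Bb; exists B.
apply: (@le_lt_trans _ _ (- d)%:E); last by rewrite lte_fin oppr_lt0.
apply: ereal_inf_lbound; exists (- d) => //; split.
  move=> z /= /ext[B rB _] hz; apply: hz; exists B; exact: rB.
exists (2 * (8 * d)^-1) => z /ext[B rB Bb].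
by rewrite (resolvent_eq rB); apply: opnorm_le => //; rewrite mulr_ge0.
Qed.
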